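(* Minimum Sum Coloring with Bundles can be solved in $O(n^6)$ time, where $n=|V|$, on instances in which $G$ is a tree, $\mathcal{B}$ is a partition of $V$, and the subgraph $G[B]$ induced by each bundle $B\in\mathcal{B}$ is connected.
   Context: Minimum Sum Coloring with Bundles: given an undirected graph $G=(V,E)$, a family $\mathcal{B}=\{B_1,\dots,B_\ell\}$ of non-empty subsets of $V$ (bundles) such that every vertex lies in at least one bundle, a weight function $w\colon\mathcal{B}\to\mathbb{Z}_{>0}$ and a positive integer $C$, decide whether there exists a proper coloring $c\colon V\to\mathbb{Z}_{>0}$ (i.e. $c(u)\ne c(v)$ for every edge $uv$) with $\mathrm{cost}(c)=\sum_{j=1}^{\ell} w(B_j)\max\{c(v)\mid v\in B_j\}\le C$ (the algorithm computes the minimum cost). *)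

(* Defs.v *)
From mathcomp Require Import all_boot.

Set Implicit Arguments.
Unset Strict Implicit.
Unset Printing Implicit Defensive.

(** * Minimum Sum Coloring with Bundles *)

Record instance := Instance {
  nvertices : nat;
  edge : rel 'I_nvertices;
  nbundles : nat;
  bundle : 'I_nbundles -> {set 'I_nvertices};
  weight : 'I_nbundles -> nat;
  budget : nat;
  edge_sym : symmetric edge;
  edge_irr : irreflexive edge;
  bundle_inj : injective bundle;
  bundle_neq0 : forall j, bundle j != set0;
  bundle_cover : \bigcup_j bundle j = [set: 'I_nvertices];
  weight_gt0 : forall j, 0 < weight j;
  budget_gt0 : 0 < budget }.

Definition proper_coloring (I : instance) (c : 'I_(nvertices I) -> nat) : Prop :=
  (forall v, 0 < c v) /\ (forall u v, edge u v -> c u != c v).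

Definition cost (I : instance) (c : 'I_(nvertices I) -> nat) : nat :=
  \sum_(j < nbundles I) weight j * \max_(v in bundle j) c v.

Arguments proper_coloring : clear implicits.
Arguments cost : clear implicits.

Definition yes_instance (I : instance) : Prop :=
  exists c, proper_coloring I c /\ cost I c <= budget I.

Definition minimum_cost (I : instance) (m : nat) : Prop :=
  (exists c, proper_coloring I c /\ cost I c = m) /\
  (forall c, proper_coloring I c -> m <= cost I c).

(** A closed walk [:: x; y] runs twice along one edge and is not a graph cycle,
    hence the bound 2. *)
Definition is_tree n (e : rel 'I_n) : Prop :=
  [/\ 0 < n, forall x y, connect e x y & forall s, ucycle e s -> size s <= 2].

Definition induced n (e : rel 'I_n) (B : {set 'I_n}) : rel 'I_n :=
  [rel u v | [&& u \in B, v \in B & e u v]].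

Definition induces_connected n (e : rel 'I_n) (B : {set 'I_n}) : Prop :=
  {in B &, forall u v, connect (induced e B) u v}.

Definition bundles_partition (I : instance) : Prop :=
  partition [set bundle j | j : 'I_(nbundles I)] [set: 'I_(nvertices I)].

Definition bundles_connected (I : instance) : Prop :=
  forall j : 'I_(nbundles I), induces_connected (@edge I) (bundle j).

(** * Word RAM

    Finitely many registers are used by a program (register indices are part of
    the instructions); the memory is accessed through addresses held in
    registers. Each instruction takes one unit of time. Words hold the naturals
    below [2 ^ b]; an instruction whose result does not fit in a word aborts the
    computation, so unit-cost arithmetic only ever applies to [b]-bit numbers. *)

Inductive arith := Add | Sub | Mul.

Inductive instr :=
| Const (d c : nat)               (* r_d <- c *)
| Arith (o : arith) (d x y : nat) (* r_d <- r_x o r_y *)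
| Read (d x : nat)                (* r_d <- mem[r_x] *)
| Write (x y : nat)               (* mem[r_x] <- r_y *)
| Jump (l : nat)
| JumpLt (x y l : nat).           (* if r_x < r_y then goto l *)

Definition program := seq instr.

Record config := Config { pc : nat; reg : nat -> nat; mem : nat -> nat }.

Definition upd (f : nat -> nat) (i x : nat) : nat -> nat :=
  fun j => if j == i then x else f j.

(** [Sub] is the truncated subtraction. *)
Definition eval_arith (o : arith) (x y : nat) : nat :=
  match o with Add => x + y | Sub => x - y | Mul => x * y end.

Definition set_reg (b : nat) (s : config) (d x : nat) : option config :=
  if x < 2 ^ b then Some (Config (pc s).+1 (upd (reg s) d x) (mem s)) else None.

Definition step (b : nat) (i : instr) (s : config) : option config :=
  match i with
  | Const d c => set_reg b s d c
  | Arith o d x y => set_reg b s d (eval_arith o (reg s x) (reg s y))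
  | Read d x => set_reg b s d (mem s (reg s x))
  | Write x y =>
      Some (Config (pc s).+1 (reg s) (upd (mem s) (reg s x) (reg s y)))
  | Jump l => Some (Config l (reg s) (mem s))
  | JumpLt x y l =>
      Some (Config (if reg s x < reg s y then l else (pc s).+1) (reg s) (mem s))
  end.

(** [run b p t s] is [Some s'] if the program started in [s] halts, by leaving
    its code, in [s'] after at most [t] instructions, and [None] if it does not
    halt in that time or aborts. *)
Fixpoint run (b : nat) (p : program) (t : nat) (s : config) : option config :=
  match onth p (pc s) with
  | None => Some s
  | Some i => if t is t'.+1 then obind (run b p t') (step b i s) else None
  end.

(** * Input and output *)

(** Number of vertices, number of bundles, budget, the adjacency matrix and the
    bundle-vertex incidence matrix (both row by row), the weights. *)
Definition encode (I : instance) : seq nat :=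
  [:: nvertices I; nbundles I; budget I]
  ++ [seq nat_of_bool (edge u v) | u <- enum 'I_(nvertices I), v <- enum 'I_(nvertices I)]
  ++ [seq nat_of_bool (v \in bundle j) |
        j <- enum 'I_(nbundles I), v <- enum 'I_(nvertices I)]
  ++ [seq weight j | j <- enum 'I_(nbundles I)].

Definition initial (I : instance) : config :=
  Config 0 (fun=> 0) (nth 0 (encode I)).

(** [k] times the number of binary digits of a number dominating the dimensions
    and all the numbers of the instance. *)
Definition word_length (k : nat) (I : instance) : nat :=
  k * (trunc_log 2 (nvertices I + nbundles I + budget I
                    + \sum_(j < nbundles I) weight j)).+1.

(** Register 0 holds the answer (1 for yes, 0 for no) to the decision problem,
    register 1 the minimum cost. *)
Definition correct_output (I : instance) (s : config) : Prop :=
  (exists b : bool, reg s 0 = b /\ (b <-> yes_instance I)) /\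
  minimum_cost I (reg s 1).

(** On the instances of the class [P], the program [p] solves the problem in
    [O(T n)] time, [n] being the number of vertices, on words of length
    logarithmic in the dimensions and numbers of the instance. *)
Definition solves_in_time (P : instance -> Prop) (T : nat -> nat)
    (p : program) : Prop :=
  exists k a : nat, forall I : instance, P I ->
    exists s : config,
      run (word_length k I) p (a * T (nvertices I)) (initial I) = Some s /\
      correct_output I s.

(* Main.v *)
From mathcomp Require Import all_boot zify.
Require Import Defs.

Set Implicit Arguments.
Unset Strict Implicit.
Unset Printing Implicit Defensive.

(** Replacing every color by its rank among the used colors shows that [n] colors
    suffice. Give each vertex [v] a state [(c, t)] in [{1..n}^2], its color and
    the maximal color allowed in its bundle, charge the weight of each bundle to
    one of its vertices, and forbid [t < c] by an infinite cost. As bundles are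
    connected, "[t] is constant on bundles" is a condition on the edges only, so
    the problem is to minimize a sum of unary costs under constraints on the
    edges of a forest. A leaf [v] with neighbor [u] is eliminated by adding to the
    cost of each state of [u] the least cost of a compatible state of [v]; this
    takes time [O(n^4)], hence [O(n^5)] for all leaves.

    The costs are capped at a number [inf] above the optimum, so every equivalence
    is about thresholds [m < inf]. On the word RAM all loops run exactly [n] times,
    so the time is bounded by a constant times [n] to the loop depth. *)

(** * A loop language and its compilation *)

(** Words abort on overflow, so every intermediate value needs a bound valid for all instances.
    Costs summed along the elimination could grow with the number of rounds; cutting each sum at
    [inf] keeps them below a fixed power of a base [X] that exceeds all input numbers, and a
    syntactic check of the program then replaces any invariant about sizes. The price is that only
    comparisons with thresholds below [inf] survive; this is harmless because some proper coloring
    costs less than [inf].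

    The state records an upper bound [t] for the colors of the bundle rather than their maximum: a
    bound can be enforced vertex by vertex and edge by edge, a maximum cannot, and minimization
    makes the bound tight.

    No root and no elimination order is computed. Each round searches the surviving vertices for one
    with a single surviving neighbor, which is cheaper than the update that follows. After [n]
    rounds no edge survives, and the remaining vertices are independent.

    All reasoning about the algorithm takes place on structured loops with invariants and frame
    conditions; the compiler and its time bound are verified once. *)

(** [ENum] is the number of vertices, which also bounds every [For] loop;
    [EInp e] reads the cell [e] of the input and [EArr a e] the cell [e] of the
    array number [a]. *)
Inductive expr :=
| EVar (x : nat)
| ECst (c : nat)
| ENum
| EBin (o : arith) (e1 e2 : expr)
| EInp (e : expr)
| EArr (a : nat) (e : expr).

Inductive cmd :=
| Skip
| Assign (x : nat) (e : expr)
| Store (a : nat) (e1 e2 : expr)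
| Seq (c1 c2 : cmd)
| IfLt (e1 e2 : expr) (c1 c2 : cmd)
| For (x : nat) (c : cmd).

Record state := State { var : nat -> nat; arr : nat -> nat -> nat }.

Definition set_var (s : state) (x i : nat) : state :=
  State (upd (var s) x i) (arr s).

Definition set_arr (s : state) (a i x : nat) : state :=
  State (var s) (fun a' => if a' == a then upd (arr s a) i x else arr s a').

(** * Semantics of the loop language and its write sets *)

Section Semantics.
Variables (n : nat) (inp : seq nat).

Fixpoint eval (s : state) (e : expr) : nat :=
  match e with
  | EVar x => var s x
  | ECst c => c
  | ENum => n
  | EBin o e1 e2 => eval_arith o (eval s e1) (eval s e2)
  | EInp e => nth 0 inp (eval s e)
  | EArr a e => arr s a (eval s e)
  end.

Fixpoint exec (c : cmd) (s : state) : state :=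
  match c with
  | Skip => s
  | Assign x e => set_var s x (eval s e)
  | Store a e1 e2 => set_arr s a (eval s e1) (eval s e2)
  | Seq c1 c2 => exec c2 (exec c1 s)
  | IfLt e1 e2 c1 c2 =>
      if eval s e1 < eval s e2 then exec c1 s else exec c2 s
  | For x c => foldl (fun s i => exec c (set_var s x i)) s (iota 0 n)
  end.

Lemma exec_for_ind (P : nat -> state -> Prop) x c s :
  P 0 s ->
  (forall i s, i < n -> P i s -> P i.+1 (exec c (set_var s x i))) ->
  P n (exec (For x c) s).
Proof.
move=> P0 PS /=.
have H : forall m i t, i + m <= n -> P i t ->
    P (i + m) (foldl (fun s i => exec c (set_var s x i)) t (iota i m)).
  elim=> [|m IH] i t /=; first by rewrite addn0.
  by rewrite addnS -addSn => le_n Pi; apply: IH => //; apply: PS => //; lia.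
exact: (H n 0 s (leqnn _) P0).
Qed.

Fixpoint wvars (c : cmd) : seq nat :=
  match c with
  | Assign x _ => [:: x]
  | Seq c1 c2 | IfLt _ _ c1 c2 => wvars c1 ++ wvars c2
  | For x c => x :: wvars c
  | _ => [::]
  end.

Fixpoint warrs (c : cmd) : seq nat :=
  match c with
  | Store a _ _ => [:: a]
  | Seq c1 c2 | IfLt _ _ c1 c2 => warrs c1 ++ warrs c2
  | For x c => warrs c
  | _ => [::]
  end.

Lemma exec_var x c s : x \notin wvars c -> var (exec c s) x = var s x.
Proof.
elim: c s => //= [y e|c1 IH1 c2 IH2|e1 e2 c1 IH1 c2 IH2|y c IH] s.
- by rewrite inE /upd => /negbTE ->.
- by rewrite mem_cat negb_or => /andP[H1 H2]; rewrite IH2 // IH1.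
- by rewrite mem_cat negb_or => /andP[/IH1 H1 /IH2 H2]; case: ifP.
- rewrite inE negb_or => /andP[/negbTE xy /IH{}IH].
  by elim: (iota 0 n) s => //= i r IHr s; rewrite IHr IH /= /upd xy.
Qed.

Lemma exec_arr a c s : a \notin warrs c -> arr (exec c s) a = arr s a.
Proof.
elim: c s => //= [b e1 e2|c1 IH1 c2 IH2|e1 e2 c1 IH1 c2 IH2|y c IH] s.
- by rewrite inE => /negbTE ->.
- by rewrite mem_cat negb_or => /andP[H1 H2]; rewrite IH2 // IH1.
- by rewrite mem_cat negb_or => /andP[/IH1 H1 /IH2 H2]; case: ifP.
- by move=> /IH{}IH; elim: (iota 0 n) s => //= i r IHr s; rewrite IHr IH.
Qed.

End Semantics.

(** Registers of the machine: two constants ([n] and the length of the input)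
    and, interleaved, the variables, the temporaries of the evaluation of
    expressions and the loop counters. Registers 0 and 1 are left for the
    output. *)
Definition rnum := 2.
Definition rlen := 3.
Definition rvar x := 3 * x + 4.
Definition rtmp j := 3 * j + 5.
Definition rctr d := 3 * d + 6.

Definition narr := 4.

(** Cell [i] of array [a] lives at address [size inp + 1 + narr * i + a]; cell
    [size inp] always contains 0. *)
Definition address a j :=
  [:: Const (rtmp j.+1) narr; Arith Mul (rtmp j) (rtmp j) (rtmp j.+1);
      Const (rtmp j.+1) a.+1; Arith Add (rtmp j) (rtmp j) (rtmp j.+1);
      Arith Add (rtmp j) (rtmp j) rlen].

Fixpoint compile_expr (e : expr) (j : nat) : program :=
  match e with
  | EVar x => [:: Const (rtmp j) 0; Arith Add (rtmp j) (rtmp j) (rvar x)]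
  | ECst c => [:: Const (rtmp j) c]
  | ENum => [:: Const (rtmp j) 0; Arith Add (rtmp j) (rtmp j) rnum]
  | EBin o e1 e2 =>
      compile_expr e1 j ++ compile_expr e2 j.+1
      ++ [:: Arith o (rtmp j) (rtmp j) (rtmp j.+1)]
  | EInp e => (* [len - (len - e)] is the minimum of [len] and [e] *)
      compile_expr e j
      ++ [:: Arith Sub (rtmp j.+1) rlen (rtmp j);
             Arith Sub (rtmp j) rlen (rtmp j.+1); Read (rtmp j) (rtmp j)]
  | EArr a e => compile_expr e j ++ address a j ++ [:: Read (rtmp j) (rtmp j)]
  end.

Fixpoint csize (c : cmd) : nat :=
  match c with
  | Skip => 0
  | Assign x e => size (compile_expr e 0) + 2
  | Store a e1 e2 => size (compile_expr e1 0) + (5 + (size (compile_expr e2 1) + 1))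
  | Seq c1 c2 => csize c1 + csize c2
  | IfLt e1 e2 c1 c2 =>
      size (compile_expr e1 0) + (size (compile_expr e2 1) +
        (1 + (csize c2 + (1 + csize c1))))
  | For x c => 5 + (csize c + 3)
  end.

(** [l] is the position of the compiled code in the program, [d] the number of
    enclosing loops. *)
Fixpoint compile (c : cmd) (l d : nat) : program :=
  match c with
  | Skip => [::]
  | Assign x e =>
      compile_expr e 0 ++ [:: Const (rvar x) 0; Arith Add (rvar x) (rvar x) (rtmp 0)]
  | Store a e1 e2 =>
      compile_expr e1 0 ++ address a 0 ++ compile_expr e2 1 ++ [:: Write (rtmp 0) (rtmp 1)]
  | Seq c1 c2 => compile c1 l d ++ compile c2 (l + csize c1) d
  | IfLt e1 e2 c1 c2 =>
      let k1 := size (compile_expr e1 0) in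
      let k2 := size (compile_expr e2 1) in
      let l2 := l + k1 + k2 + 1 in
      let l1 := l2 + csize c2 + 1 in
      compile_expr e1 0 ++ compile_expr e2 1 ++ [:: JumpLt (rtmp 0) (rtmp 1) l1]
      ++ compile c2 l2 d ++ [:: Jump (l1 + csize c1)] ++ compile c1 l1 d
  | For x c =>
      [:: Const (rctr d) 0; JumpLt (rctr d) rnum (l + 3);
          Jump (l + 5 + csize c + 3);
          Const (rvar x) 0; Arith Add (rvar x) (rvar x) (rctr d)]
      ++ compile c (l + 5) d.+1
      ++ [:: Const (rtmp 0) 1; Arith Add (rctr d) (rctr d) (rtmp 0); Jump (l + 1)]
  end.

Lemma size_compile c l d : size (compile c l d) = csize c.
Proof.
elim: c l d => //=.
- by move=> x e l d; rewrite size_cat.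
- by move=> a e1 e2 l d; rewrite !size_cat /= !size_cat.
- by move=> c1 IH1 c2 IH2 l d; rewrite size_cat IH1 IH2.
- by move=> e1 e2 c1 IH1 c2 IH2 l d; rewrite !(size_cat, IH1, IH2) /= size_cat IH2 /= IH1.
- by move=> x c IH l d; rewrite !size_cat IH.
Qed.

(** ** Time *)

Fixpoint depth (c : cmd) : nat :=
  match c with
  | Seq c1 c2 | IfLt _ _ c1 c2 => maxn (depth c1) (depth c2)
  | For x c => (depth c).+1
  | _ => 0
  end.

(** The constant in the time bound [cmd_cost c * n ^ depth c]. Both branches of a conditional are
    charged. A loop adds 10, which covers 7 per round and 3 for entry and exit, all absorbed by one
    more factor [n >= 1]. *)
Fixpoint cmd_cost (c : cmd) : nat :=
  match c with
  | Seq c1 c2 => cmd_cost c1 + cmd_cost c2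
  | IfLt e1 e2 c1 c2 =>
      size (compile_expr e1 0) + size (compile_expr e2 1) + 2 + cmd_cost c1 + cmd_cost c2
  | For x c => cmd_cost c + 10
  | _ => csize c
  end.

(** * Timed reachability of configurations and placement of code *)

Section Reach.
Variables (b : nat) (p : program).

(** Quantifying over the remaining fuel [t'] makes the relation compose by addition of times, while
    [t0 <= t] lets bounds be weakened freely. *)
Definition reach (t : nat) (s s' : config) : Prop :=
  exists2 t0, t0 <= t & forall t', run b p (t0 + t') s = run b p t' s'.

Lemma reach_refl t s : reach t s s.
Proof. by exists 0. Qed.

Lemma reach_trans t1 t2 s1 s2 s3 :
  reach t1 s1 s2 -> reach t2 s2 s3 -> reach (t1 + t2) s1 s3.
Proof.
move=> [u1 le1 H1] [u2 le2 H2]; exists (u1 + u2); first lia.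
by move=> t'; rewrite -addnA H1 H2.
Qed.

Lemma reach_leq t1 t2 s1 s2 : t1 <= t2 -> reach t1 s1 s2 -> reach t2 s1 s2.
Proof. by move=> le [u leu H]; exists u => //; lia. Qed.

Lemma reach_step i s s' :
  onth p (pc s) = Some i -> step b i s = Some s' -> reach 1 s s'.
Proof. by move=> pi si; exists 1 => // t'; rewrite add1n /= pi si. Qed.

Definition code_at (l : nat) (q : program) : Prop :=
  exists2 p1, size p1 = l & exists p2, p = p1 ++ q ++ p2.

Lemma code_at_cat l q1 q2 :
  code_at l (q1 ++ q2) -> code_at l q1 /\ code_at (l + size q1) q2.
Proof.
move=> [p1 sp1 [p2 Ep]]; split.
  by exists p1 => //; exists (q2 ++ p2); rewrite Ep !catA.
by exists (p1 ++ q1); [rewrite size_cat sp1|exists p2; rewrite Ep !catA].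
Qed.

Lemma code_at_cons l i q : code_at l (i :: q) -> onth p l = Some i /\ code_at l.+1 q.
Proof.
rewrite -cat1s => /code_at_cat[[p1 <- [p2 Ep]] H]; rewrite addn1 in H; split=> //.
by rewrite Ep onth_cat ltnn subnn.
Qed.

Lemma reach_const d c s : onth p (pc s) = Some (Const d c) -> c < 2 ^ b ->
  reach 1 s (Config (pc s).+1 (upd (reg s) d c) (mem s)).
Proof. by move=> /reach_step H cb; apply: H; rewrite /= /set_reg cb. Qed.

Lemma reach_arith o d x y s : onth p (pc s) = Some (Arith o d x y) ->
  eval_arith o (reg s x) (reg s y) < 2 ^ b ->
  reach 1 s (Config (pc s).+1
    (upd (reg s) d (eval_arith o (reg s x) (reg s y))) (mem s)).
Proof. by move=> /reach_step H cb; apply: H; rewrite /= /set_reg cb. Qed.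

Lemma reach_read d x s : onth p (pc s) = Some (Read d x) ->
  mem s (reg s x) < 2 ^ b ->
  reach 1 s (Config (pc s).+1 (upd (reg s) d (mem s (reg s x))) (mem s)).
Proof. by move=> /reach_step H cb; apply: H; rewrite /= /set_reg cb. Qed.

Lemma run_reach t s s' : reach t s s' -> onth p (pc s') = None -> run b p t s = Some s'.
Proof.
move=> [u ut H] pn; have -> : t = u + (t - u) by lia.
by rewrite H; case: (t - u) => [|m] /=; rewrite pn.
Qed.

End Reach.

(** ** Correctness of the compiler *)

(** Every variable [x] and every array holds numbers below [X ^ dv x] and
    [X ^ da] respectively; the checks below, which are static, propagate these
    exponents to expressions and compare them with the exponent [k] of the word
    length [b]. *)
Section Compiler.
Variables (n : nat) (inp : seq nat) (X k b da : nat) (dv : nat -> nat) (p : program).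

(** Truncated subtraction keeps the exponent of its left operand. Hence a minimum written
    [e1 - (e1 - e2)] has the exponent of [e1] however large [e2] is, which is what allows repeated
    capped additions into one variable. *)
Fixpoint magnitude (e : expr) : nat :=
  match e with
  | EVar x => dv x
  | ECst c => c
  | ENum => 1
  | EBin Add e1 e2 => (maxn (magnitude e1) (magnitude e2)).+1
  | EBin Sub e1 e2 => magnitude e1
  | EBin Mul e1 e2 => magnitude e1 + magnitude e2
  | EInp _ => 1
  | EArr _ _ => da
  end.

Fixpoint fits_expr (e : expr) : bool :=
  (magnitude e <= k) &&
  match e with
  | EBin _ e1 e2 => fits_expr e1 && fits_expr e2
  | EInp e => fits_expr e
  | EArr a e => [&& fits_expr e, a < narr & magnitude e + 6 <= k]
  | _ => true
  end.

Fixpoint fits (c : cmd) : bool :=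
  match c with
  | Skip => true
  | Assign x e => fits_expr e && (magnitude e <= dv x)
  | Store a e1 e2 =>
      [&& fits_expr e1, fits_expr e2, a < narr, magnitude e1 + 6 <= k & magnitude e2 <= da]
  | Seq c1 c2 => fits c1 && fits c2
  | IfLt e1 e2 c1 c2 => [&& fits_expr e1, fits_expr e2, fits c1 & fits c2]
  | For x c => (1 <= dv x <= k) && fits c
  end.

Definition bounded (s : state) : Prop :=
  (forall x, var s x < X ^ dv x) /\ (forall a i, arr s a i < X ^ da).

(** Since the arrays are interleaved, every index of every array owns a cell, and no array sizes
    have to be tracked. *)
Record represents (s : state) (m : config) : Prop := Represents {
  rep_num : reg m rnum = n;
  rep_len : reg m rlen = size inp;
  rep_var : forall x, reg m (rvar x) = var s x;
  rep_inp : forall i, i <= size inp -> mem m i = nth 0 inp i;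
  rep_arr : forall a i, a < narr -> mem m ((size inp).+1 + i * narr + a) = arr s a i }.

Hypothesis X_gt1 : 1 < X.
Hypothesis n_gt0 : 0 < n.
Hypothesis n_ltX : n < X.
Hypothesis k_ge4 : 4 <= k.
Hypothesis inp_ltX : forall i, nth 0 inp i < X.
Hypothesis size_ltX : size inp < X ^ 4.
Hypothesis X_fits : X ^ k <= 2 ^ b.

Notation reach := (reach b p).
Notation code_at := (code_at p).

Lemma ltn_pow c : c < X ^ c.
Proof. exact: ltn_expl. Qed.

Lemma leq_pow i j : i <= j -> X ^ i <= X ^ j.
Proof. by move=> ij; rewrite leq_exp2l. Qed.

Lemma ltn_powW x i j : i <= j -> x < X ^ i -> x < X ^ j.
Proof. by move=> /leq_pow H1 H2; apply: leq_trans H1. Qed.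

Lemma word_fits x i : i <= k -> x < X ^ i -> x < 2 ^ b.
Proof. by move=> ik /(ltn_powW ik) H; apply: leq_trans X_fits. Qed.

Lemma ltn_powD x y i : x < X ^ i -> y < X ^ i -> x + y < X ^ i.+1.
Proof.
move=> xi yi; rewrite expnS; apply: (@leq_trans (2 * X ^ i)); first lia.
by rewrite leq_mul2r X_gt1 orbT.
Qed.

Lemma ltn_powM x y i j : x < X ^ i -> y < X ^ j -> x * y < X ^ (i + j).
Proof. by move=> xi yj; rewrite expnD; apply: ltn_mul. Qed.

Lemma eval_magnitude s e : bounded s -> eval n inp s e < X ^ magnitude e.
Proof.
move=> [bv ba]; elim: e => //=.
- exact: ltn_pow.
- case=> e1 IH1 e2 IH2 /=.
  + apply: ltn_powD; [apply: ltn_powW IH1|apply: ltn_powW IH2].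
      exact: leq_maxl.
    exact: leq_maxr.
  + exact: leq_ltn_trans (leq_subr _ _) _.
  + exact: ltn_powM.
Qed.

Lemma magnitude_fits e : fits_expr e -> magnitude e <= k.
Proof. by case: e => [x|c||o e1 e2|e|a e] /andP[]. Qed.

Lemma represents_regs s s' m q f : represents s m -> arr s' = arr s ->
  f rnum = reg m rnum -> f rlen = reg m rlen ->
  (forall x, f (rvar x) = var s' x) -> represents s' (Config q f (mem m)).
Proof.
move=> [H1 H2 H3 H4 H5] Ea En El Ev; split.
- by rewrite -H1.
- by rewrite -H2.
- exact: Ev.
- exact: H4.
- by rewrite Ea; exact: H5.
Qed.

Lemma represents_pc s m q : represents s m -> represents s (Config q (reg m) (mem m)).
Proof. by move=> R; apply: represents_regs R _ _ _ (rep_var R). Qed.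

(** The stack discipline of expression evaluation: only temporaries from [j] on may change, so a
    left operand kept in [rtmp j] survives the evaluation of the right one at [j.+1]. *)
Definition same_upto j (m m' : config) : Prop :=
  mem m' = mem m /\
  forall r, (forall i, j <= i -> r <> rtmp i) -> reg m' r = reg m r.

Lemma same_upto_represents s j m m' :
  represents s m -> same_upto j m m' -> represents s m'.
Proof.
move=> [H1 H2 H3 H4 H5] [Em Er].
split; rewrite ?Em //.
- by rewrite Er // => i _; rewrite /rnum /rtmp; lia.
- by rewrite Er // => i _; rewrite /rlen /rtmp; lia.
- by move=> x; rewrite Er // => i _; rewrite /rvar /rtmp; lia.
Qed.

Lemma same_upto_trans i j m1 m2 m3 : i <= j ->
  same_upto i m1 m2 -> same_upto j m2 m3 -> same_upto i m1 m3.
Proof.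
move=> ij [E1 H1] [E2 H2]; split; first by rewrite E2.
by move=> r Hr; rewrite H2 ?H1 // => h jh; apply: Hr; lia.
Qed.

Lemma same_upto_upd i j m1 m x q : i <= j -> same_upto i m1 m ->
  same_upto i m1 (Config q (upd (reg m) (rtmp j) x) (mem m)).
Proof.
move=> ij [Em Er]; split=> //= r Hr; rewrite /upd.
by case: eqP => [E|_]; [case: (Hr j ij)|apply: Er].
Qed.

Lemma same_upto_refl j m : same_upto j m m.
Proof. by []. Qed.

Lemma rtmp_eqS j : (rtmp j == rtmp j.+1) = false.
Proof. by rewrite /rtmp; lia. Qed.
Lemma rtmpS_eq j : (rtmp j.+1 == rtmp j) = false.
Proof. by rewrite /rtmp; lia. Qed.
Lemma rlen_rtmp j : (rlen == rtmp j) = false.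
Proof. by rewrite /rtmp /rlen; lia. Qed.
Lemma rnum_rtmp j : (rnum == rtmp j) = false.
Proof. by rewrite /rtmp /rnum; lia. Qed.
Lemma rvar_rtmp x j : (rvar x == rtmp j) = false.
Proof. by rewrite /rtmp /rvar; lia. Qed.
Lemma rctr_rtmp x j : (rctr x == rtmp j) = false.
Proof. by rewrite /rtmp /rctr; lia. Qed.
Lemma rnum_rvar j : (rnum == rvar j) = false.
Proof. by rewrite /rvar /rnum; lia. Qed.
Lemma rlen_rvar j : (rlen == rvar j) = false.
Proof. by rewrite /rvar /rlen; lia. Qed.
Lemma rctr_rvar x j : (rctr x == rvar j) = false.
Proof. by rewrite /rvar /rctr; lia. Qed.
Lemma rnum_rctr j : (rnum == rctr j) = false.
Proof. by rewrite /rctr /rnum; lia. Qed.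
Lemma rlen_rctr j : (rlen == rctr j) = false.
Proof. by rewrite /rctr /rlen; lia. Qed.
Lemma rvar_rctr x j : (rvar x == rctr j) = false.
Proof. by rewrite /rvar /rctr; lia. Qed.
Lemma rvar_rvar x y : (rvar x == rvar y) = (x == y).
Proof. by rewrite /rvar; lia. Qed.
Lemma rctr_rctr x y : (rctr x == rctr y) = (x == y).
Proof. by rewrite /rctr; lia. Qed.

Definition regE := (rtmp_eqS, rtmpS_eq, rlen_rtmp, rnum_rtmp, rvar_rtmp, rctr_rtmp,
  rnum_rvar, rlen_rvar, rctr_rvar, rnum_rctr, rlen_rctr, rvar_rctr, rvar_rvar,
  rctr_rctr, eqxx).

Lemma reach_address s a e j m :
  represents s m -> code_at (pc m) (address a j) ->
  reg m (rtmp j) < X ^ e -> a < narr -> e + 6 <= k ->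
  exists m', [/\ reach 5 m m', pc m' = pc m + 5, same_upto j m m' &
    reg m' (rtmp j) = (size inp).+1 + reg m (rtmp j) * narr + a].
Proof.
move=> R + lte lta lek.
rewrite /address => /code_at_cons[P1] /code_at_cons[P2] /code_at_cons[P3]
  /code_at_cons[P4] /code_at_cons[P5 _].
set x := reg m (rtmp j) in lte *.
(* Origin of the 6: the factor [narr = 4] is below [X ^ 4], and each of the two additions costs one
   more exponent. *)
have B1 : narr < X ^ 4 by apply: ltn_pow.
have B2 : x * narr < X ^ (e + 4) by apply: ltn_powM.
have B3 : x * narr + a.+1 < X ^ (e + 5).
  rewrite (addnS e 4); apply: ltn_powD => //; apply: leq_ltn_trans lta _.
  by apply: ltn_powW B1; lia.
have B4 : x * narr + a.+1 + size inp < X ^ (e + 6).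
  by rewrite (addnS e 5); apply: ltn_powD => //; apply: ltn_powW size_ltX; lia.
pose m1 := Config (pc m).+1 (upd (reg m) (rtmp j.+1) narr) (mem m).
have R1 : reach 1 m m1 by apply: reach_const => //; apply: word_fits B1.
pose m2 := Config (pc m).+2 (upd (reg m1) (rtmp j) (x * narr)) (mem m1).
have R2 : reach 1 m1 m2.
  have := @reach_arith b p Mul (rtmp j) (rtmp j) (rtmp j.+1) m1 P2.
  by rewrite /m1 /= /upd !regE; apply; apply: word_fits B2; lia.
pose m3 := Config (pc m).+3 (upd (reg m2) (rtmp j.+1) a.+1) (mem m2).
have R3 : reach 1 m2 m3.
  apply: reach_const => //; apply: (@word_fits _ 4) => //.
  exact: leq_ltn_trans lta B1.
pose m4 := Config (pc m).+4 (upd (reg m3) (rtmp j) (x * narr + a.+1)) (mem m3).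
have R4 : reach 1 m3 m4.
  have := @reach_arith b p Add (rtmp j) (rtmp j) (rtmp j.+1) m3 P4.
  by rewrite /= /upd !regE; apply; apply: word_fits B3; lia.
pose m5 := Config (pc m).+4.+1 (upd (reg m4) (rtmp j) (x * narr + a.+1 + size inp)) (mem m4).
have R5 : reach 1 m4 m5.
  have := @reach_arith b p Add (rtmp j) (rtmp j) rlen m4 P5.
  rewrite /= /upd !regE (rep_len R).
  by apply; apply: word_fits B4.
exists m5; split.
- exact: reach_trans R1 (reach_trans R2 (reach_trans R3 (reach_trans R4 R5))).
- by rewrite /=; lia.
- do 5 (apply: same_upto_upd; first lia); exact: same_upto_refl.
- by rewrite /= /upd eqxx; lia.
Qed.

Lemma reach_expr s e j m :
  bounded s -> represents s m -> fits_expr e -> code_at (pc m) (compile_expr e j) ->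
  exists m', [/\ reach (size (compile_expr e j)) m m',
    pc m' = pc m + size (compile_expr e j), same_upto j m m' &
    reg m' (rtmp j) = eval n inp s e].
Proof.
move=> bs; elim: e j m => [x|c| |o e1 IH1 e2 IH2|e IH|a e IH] j m R /=.
- move=> /andP[dx _] /code_at_cons[P1] /code_at_cons[P2 _].
  pose m1 := Config (pc m).+1 (upd (reg m) (rtmp j) 0) (mem m).
  have R1 : reach 1 m m1 by apply: reach_const => //; rewrite expn_gt0.
  pose m2 := Config (pc m).+2 (upd (reg m1) (rtmp j) (var s x)) (mem m1).
  have R2 : reach 1 m1 m2.
    have := @reach_arith b p Add (rtmp j) (rtmp j) (rvar x) m1 P2.
    rewrite /m1 /= /upd !regE (rep_var R); apply.
    by apply: word_fits dx _; apply: bs.1.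
  exists m2; split; rewrite ?addn2 //; first exact: reach_trans R1 R2.
    by do 2 (apply: same_upto_upd; first lia); exact: same_upto_refl.
  by rewrite /= /upd eqxx.
- move=> /andP[dx _] /code_at_cons[P1 _].
  exists (Config (pc m).+1 (upd (reg m) (rtmp j) c) (mem m)); split; rewrite ?addn1 //.
  + by apply: reach_const => //; apply: word_fits dx _; apply: ltn_pow.
  + by apply: same_upto_upd => //; exact: same_upto_refl.
  + by rewrite /= /upd eqxx.
- move=> /andP[dx _] /code_at_cons[P1] /code_at_cons[P2 _].
  pose m1 := Config (pc m).+1 (upd (reg m) (rtmp j) 0) (mem m).
  have R1 : reach 1 m m1 by apply: reach_const => //; rewrite expn_gt0.
  pose m2 := Config (pc m).+2 (upd (reg m1) (rtmp j) n) (mem m1).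
  have R2 : reach 1 m1 m2.
    have := @reach_arith b p Add (rtmp j) (rtmp j) rnum m1 P2.
    rewrite /m1 /= /upd !regE (rep_num R); apply.
    by apply: word_fits dx _; rewrite expn1.
  exists m2; split; rewrite ?addn2 //; first exact: reach_trans R1 R2.
    by do 2 (apply: same_upto_upd; first lia); exact: same_upto_refl.
  by rewrite /= /upd eqxx.
- move=> /andP[dx /andP[f1 f2]] /code_at_cat[C1] /code_at_cat[C2].
  move=> /code_at_cons[P3 _].
  have [m1 [R1 pc1 S1 E1]] := IH1 j m R f1 C1.
  have Rep1 := same_upto_represents R S1.
  rewrite -pc1 in C2 P3.
  have [m2 [R2 pc2 S2 E2]] := IH2 j.+1 m1 Rep1 f2 C2.
  rewrite -pc2 in P3.
  have E1' : reg m2 (rtmp j) = eval n inp s e1.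
    by rewrite S2.2 // => i; rewrite /rtmp; lia.
  exists (Config (pc m2).+1 (upd (reg m2) (rtmp j)
            (eval_arith o (eval n inp s e1) (eval n inp s e2))) (mem m2)); split.
  + rewrite !size_cat /= ; apply: reach_trans R1 _; apply: reach_trans R2 _.
    have := reach_arith P3; rewrite E1' E2; apply; apply: word_fits dx _.
    exact: (eval_magnitude (EBin o e1 e2) bs).
  + by rewrite !size_cat /=; lia.
  + by apply: same_upto_upd => //; apply: same_upto_trans S2.
  + by rewrite /= /upd eqxx.
- move=> /andP[dx f] /code_at_cat[C1].
  move=> /code_at_cons[P1] /code_at_cons[P2] /code_at_cons[P3 _].
  have [m1 [R1 pc1 S1 E1]] := IH j m R f C1.
  have Rep1 := same_upto_represents R S1.
  rewrite -pc1 in P1 P2 P3.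
  have fit x : x <= size inp -> x < 2 ^ b.
    by move=> le; apply: word_fits k_ge4 _; exact: leq_ltn_trans le size_ltX.
  set x := eval n inp s e in E1 *.
  pose m2 := Config (pc m1).+1 (upd (reg m1) (rtmp j.+1) (size inp - x)) (mem m1).
  have R2 : reach 1 m1 m2.
    have := @reach_arith b p Sub (rtmp j.+1) rlen (rtmp j) m1 P1.
    by rewrite /= (rep_len Rep1) E1; apply; apply: fit; lia.
  pose m3 := Config (pc m1).+2 (upd (reg m2) (rtmp j) (size inp - (size inp - x))) (mem m1).
  have R3 : reach 1 m2 m3.
    have := @reach_arith b p Sub (rtmp j) rlen (rtmp j.+1) m2 P2.
    by rewrite /= /upd !regE (rep_len Rep1); apply; apply: fit; lia.
  (* An index beyond the input is clamped to [size inp], whose cell holds 0, the default value of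
     [nth]. *)
  have E3 : mem m3 (reg m3 (rtmp j)) = nth 0 inp x.
    rewrite /m3 /= /upd eqxx (rep_inp Rep1); last by lia.
    case: (leqP x (size inp)) => hx; first by congr nth; lia.
    have -> : size inp - (size inp - x) = size inp by lia.
    by rewrite nth_default // nth_default //; lia.
  exists (Config (pc m1).+3 (upd (reg m3) (rtmp j) (nth 0 inp x)) (mem m3)); split.
  + rewrite !size_cat /=; apply: reach_trans R1 (reach_trans R2 (reach_trans R3 _)).
    have := @reach_read b p (rtmp j) (rtmp j) m3 P3; rewrite E3; apply.
    by apply: (@word_fits _ 1); [lia|rewrite expn1].
  + by rewrite !size_cat /=; lia.
  + do 3 (apply: same_upto_upd; first lia); exact: S1.
  + by rewrite /= /upd eqxx.
- move=> /andP[dx /and3P[f lta lek]] /code_at_cat[C1].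
  move=> /(@code_at_cat _ _ (address a j))[C2] /code_at_cons[P3 _].
  have [m1 [R1 pc1 S1 E1]] := IH j m R f C1.
  have Rep1 := same_upto_represents R S1.
  rewrite -pc1 in C2 P3.
  have lte : reg m1 (rtmp j) < X ^ magnitude e by rewrite E1; apply: eval_magnitude.
  have [m2 [R2 pc2 S2 E2]] := reach_address Rep1 C2 lte lta lek.
  have Rep2 := same_upto_represents Rep1 S2.
  have E3 : mem m2 (reg m2 (rtmp j)) = arr s a (eval n inp s e).
    by rewrite E2 (rep_arr Rep2) // E1.
  rewrite -[_ + size _]pc2 in P3.
  exists (Config (pc m2).+1 (upd (reg m2) (rtmp j) (arr s a (eval n inp s e))) (mem m2)); split.
  + rewrite !size_cat /=; apply: reach_trans R1 (reach_trans R2 _).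
    have := reach_read P3; rewrite E3; apply.
    by apply: word_fits dx _; apply: bs.2.
  + by rewrite !size_cat /=; lia.
  + by apply: same_upto_upd => //; apply: same_upto_trans S2.
  + by rewrite /= /upd eqxx.
Qed.

Lemma bounded_set_var s x i : bounded s -> i < X ^ dv x -> bounded (set_var s x i).
Proof. by move=> [bv ba] ix; split=> //= y; rewrite /upd; case: eqP => [->|]. Qed.

Lemma bounded_set_arr s a i x : bounded s -> x < X ^ da -> bounded (set_arr s a i x).
Proof.
move=> [bv ba] ix; split=> //= a' i'.
by case: eqP => // _; rewrite /upd; case: eqP.
Qed.

(** Boundedness is carried through the induction because it is what prevents the machine from
    aborting. The last clause protects the counters of the enclosing loops; a counter is distinct
    from its loop variable, so a body that overwrites the variable does not disturb the
    iteration. *)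
Lemma reach_cmd c d s m :
  bounded s -> represents s m -> fits c -> code_at (pc m) (compile c (pc m) d) ->
  bounded (exec n inp c s) /\
  exists m', [/\ reach (cmd_cost c * n ^ depth c) m m',
    pc m' = pc m + csize c, represents (exec n inp c s) m' &
    forall d', d' < d -> reg m' (rctr d') = reg m (rctr d')].
Proof.
have ctr_same j m1 m2 d' : same_upto j m1 m2 -> reg m2 (rctr d') = reg m1 (rctr d').
  by move=> [_]; apply=> i _; rewrite /rctr /rtmp; lia.
have npow i : 0 < n ^ i by rewrite expn_gt0 n_gt0.
elim: c d s m => [|x e|a e1 e2|c1 IH1 c2 IH2|e1 e2 c1 IH1 c2 IH2|x c IH] d s m bs R /=.
- by move=> _ _; split=> //; exists m; split; rewrite ?addn0 //; apply: reach_refl.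
- move=> /andP[f le] /code_at_cat[C1] /code_at_cons[P2] /code_at_cons[P3 _].
  have be := eval_magnitude e bs.
  split; first by apply: bounded_set_var => //; apply: ltn_powW be.
  have [m1 [R1 pc1 S1 E1]] := reach_expr bs R f C1.
  have Rep1 := same_upto_represents R S1.
  rewrite -pc1 in P2 P3.
  pose m2 := Config (pc m1).+1 (upd (reg m1) (rvar x) 0) (mem m1).
  have R2 : reach 1 m1 m2 by apply: reach_const => //; rewrite expn_gt0.
  pose m3 := Config (pc m1).+2 (upd (reg m2) (rvar x) (eval n inp s e)) (mem m1).
  have R3 : reach 1 m2 m3.
    have := @reach_arith b p Add (rvar x) (rvar x) (rtmp 0) m2 P3.
    rewrite /m2 /= /upd !regE [rtmp _ == _]eq_sym !regE E1; apply.
    exact: word_fits (magnitude_fits f) be.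
  exists m3; split.
  + rewrite muln1; exact: reach_trans R1 (reach_trans R2 R3).
  + by rewrite /=; lia.
  + refine (@represents_regs _ _ _ _ _ Rep1 _ _ _ _); rewrite /= /upd ?regE // => y.
    by rewrite !regE (rep_var Rep1); case: (y == x).
  + by move=> d' _; rewrite /= /upd !regE; apply: ctr_same S1.
- move=> /and5P[f1 f2 lta lek le2] /code_at_cat[C1].
  move=> /(@code_at_cat _ _ (address a 0))[C2] /code_at_cat[C3] /code_at_cons[P4 _].
  have be1 := eval_magnitude e1 bs.
  have be2 := eval_magnitude e2 bs.
  split; first by apply: bounded_set_arr => //; apply: ltn_powW be2.
  have [m1 [R1 pc1 S1 E1]] := reach_expr bs R f1 C1.
  have Rep1 := same_upto_represents R S1.
  rewrite -pc1 in C2 C3 P4.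
  have lte : reg m1 (rtmp 0) < X ^ magnitude e1 by rewrite E1.
  have [m2 [R2 pc2 S2 E2]] := reach_address Rep1 C2 lte lta lek.
  have Rep2 := same_upto_represents Rep1 S2.
  rewrite -[_ + size (address _ _)]pc2 in C3 P4.
  have [m3 [R3 pc3 S3 E3]] := reach_expr bs Rep2 f2 C3.
  have Rep3 := same_upto_represents Rep2 S3.
  rewrite -pc3 in P4.
  have E2' : reg m3 (rtmp 0) = (size inp).+1 + eval n inp s e1 * narr + a.
    by rewrite S3.2 ?E2 ?E1 // => i; rewrite /rtmp; lia.
  exists (Config (pc m3).+1 (reg m3) (upd (mem m3) (reg m3 (rtmp 0)) (reg m3 (rtmp 1)))); split.
  + rewrite muln1; apply: reach_trans R1 (reach_trans R2 (reach_trans R3 _)).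
    exact: (reach_step (b := b) P4 erefl).
  + by rewrite /=; lia.
  + rewrite E2' E3; case: Rep3 => H1 H2 H3 H4 H5.
    split; [exact: H1|exact: H2|exact: H3| |]; rewrite [mem _]/=.
    * by move=> i le; rewrite /upd; case: eqP => [|_]; [lia|apply: H4].
    * move=> a' i' lta'; rewrite /set_arr [arr _]/= /upd.
      case: (altP (a' =P a)) => [->|na].
        case: (altP (i' =P eval n inp s e1)) => [->|ni]; first by rewrite !eqxx.
        have -> : ((size inp).+1 + i' * narr + a == (size inp).+1 + eval n inp s e1 * narr + a) = false.
          by move: ni; rewrite /narr; lia.
        exact: H5.
      have -> : ((size inp).+1 + i' * narr + a' == (size inp).+1 + eval n inp s e1 * narr + a) = false.
        by move: na lta lta'; rewrite /narr; lia.
      exact: H5.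
  + by move=> d' _ /=; rewrite (ctr_same _ _ _ _ S3) (ctr_same _ _ _ _ S2) (ctr_same _ _ _ _ S1).
- move=> /andP[f1 f2] /code_at_cat[C1]; rewrite size_compile => C2.
  have [bs1 [m1 [R1 pc1 Rep1 K1]]] := IH1 d s m bs R f1 C1.
  rewrite -pc1 in C2.
  have [bs2 [m2 [R2 pc2 Rep2 K2]]] := IH2 d _ m1 bs1 Rep1 f2 C2.
  split=> //; exists m2; split=> //.
  + apply: reach_leq (reach_trans R1 R2); rewrite mulnDl leq_add // leq_mul2l.
      by rewrite leq_pexp2l ?leq_maxl ?orbT.
    by rewrite leq_pexp2l ?leq_maxr ?orbT.
  + by lia.
  + by move=> d' dd'; rewrite K2 ?K1.
- move=> /and4P[f1 f2 fc1 fc2] /code_at_cat[C1] /code_at_cat[C2] /code_at_cons[P3].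
  move=> /code_at_cat[C4]; rewrite size_compile => /code_at_cons[P5 C6].
  have [m1 [R1 pc1 S1 E1]] := reach_expr bs R f1 C1.
  have Rep1 := same_upto_represents R S1.
  rewrite -pc1 in C2 P3 C4 P5 C6 *.
  have [m2 [R2 pc2 S2 E2]] := reach_expr bs Rep1 f2 C2.
  have Rep2 := same_upto_represents Rep1 S2.
  rewrite -pc2 in P3 C4 P5 C6 *.
  have E1' : reg m2 (rtmp 0) = eval n inp s e1.
    by rewrite S2.2 // => i; rewrite /rtmp; lia.
  have R3 := reach_step P3 (b := b) erefl; rewrite /= E1' E2 in R3.
  set q1 := size (compile_expr e1 0) in pc1 R1 *.
  set q2 := size (compile_expr e2 1) in pc2 R2 *.
  case: ifP R3 => _ R3.
  + set m3 := Config _ _ _ in R3.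
    have Rep3 : represents s m3 by apply: represents_pc.
    have C6' : code_at (pc m3) (compile c1 (pc m3) d).
      by move: C6; rewrite /= !addn1.
    have [bs4 [m4 [R4 pc4 Rep4 K4]]] := IH1 d s m3 bs Rep3 fc1 C6'.
    split=> //; exists m4; split=> //.
    * apply: reach_leq (reach_trans R1 (reach_trans R2 (reach_trans R3 R4))).
      have := npow (maxn (depth c1) (depth c2)).
      have : n ^ depth c1 <= n ^ maxn (depth c1) (depth c2) by rewrite leq_pexp2l ?leq_maxl.
      by nia.
    * by rewrite pc4 /=; lia.
    * by move=> d' dd'; rewrite K4 //= (ctr_same _ _ _ _ S2) (ctr_same _ _ _ _ S1).
  + set m3 := Config _ _ _ in R3.
    have Rep3 : represents s m3 by apply: represents_pc.
    have C4' : code_at (pc m3) (compile c2 (pc m3) d).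
      by move: C4; rewrite /= !addn1.
    have [bs4 [m4 [R4 pc4 Rep4 K4]]] := IH2 d s m3 bs Rep3 fc2 C4'.
    rewrite (_ : (pc m2).+1 + csize c2 = pc m4) in P5; last by rewrite pc4.
    have R5 := reach_step P5 (b := b) erefl.
    set m5 := Config _ _ _ in R5.
    have Rep5 : represents (exec n inp c2 s) m5 by apply: represents_pc.
    split=> //; exists m5; split=> //.
    * apply: reach_leq (reach_trans R1 (reach_trans R2 (reach_trans R3 (reach_trans R4 R5)))).
      have := npow (maxn (depth c1) (depth c2)).
      have : n ^ depth c2 <= n ^ maxn (depth c1) (depth c2) by rewrite leq_pexp2l ?leq_maxr.
      by nia.
    * by rewrite /=; lia.
    * by move=> d' dd'; rewrite /= K4 //= (ctr_same _ _ _ _ S2) (ctr_same _ _ _ _ S1).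
- move=> /andP[/andP[dx1 dxk] fc].
  move=> /code_at_cons[P1] /code_at_cons[P2] /code_at_cons[P3] /code_at_cons[P4] /code_at_cons[P5].
  move=> /code_at_cat[C6]; rewrite size_compile => /code_at_cons[P7] /code_at_cons[P8] /code_at_cons[P9 _].
  have nfit i : i <= n -> i < 2 ^ b.
    by move=> le; apply: (@word_fits _ 1); [lia|rewrite expn1; lia].
  pose T := cmd_cost c * n ^ depth c + 7.
  pose l := pc m.
  (* Induction on the number [r] of remaining rounds, starting at the loop test. [T] covers the body
     and the six instructions around it; the final 2 pays for the failing test and the exit jump. *)
  have loop : forall r i t m1, i + r = n -> bounded t -> represents t m1 ->
      pc m1 = l.+1 -> reg m1 (rctr d) = i ->
      (forall d', d' < d -> reg m1 (rctr d') = reg m (rctr d')) ->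
      let t' := foldl (fun s i => exec n inp c (set_var s x i)) t (iota i r) in
      bounded t' /\ exists m', [/\ reach (r * T + 2) m1 m', pc m' = l + (5 + (csize c + 3)),
        represents t' m' & forall d', d' < d -> reg m' (rctr d') = reg m (rctr d')].
    elim=> [|r IHr] i t m1 irn bt R1 pc1 ci K1 /=.
      split=> //.
      have RA := @reach_step b p _ _ _ (etrans (congr1 (onth p) pc1) P2) erefl.
      rewrite /= ci (rep_num R1) in RA.
      have /negbTE ni : ~~ (i < n) by lia.
      rewrite ni pc1 in RA.
      have RB := @reach_step b p _ (Config l.+2 (reg m1) (mem m1)) _ P3 erefl.
      set m' := Config (_ + 3) _ _ in RB.
      exists m'; split=> //.
      + by apply: reach_leq (reach_trans RA RB); lia.
      + by rewrite /= /l; lia.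
      + exact: (@represents_pc _ _ (pc m') R1).
    have ltin : i < n by lia.
    have RA := @reach_step b p _ _ _ (etrans (congr1 (onth p) pc1) P2) erefl.
    rewrite /= ci (rep_num R1) ltin in RA.
    have E3 : l + 3 = l.+3 by lia.
    set m2 := Config _ _ _ in RA.
    have pc2 : pc m2 = l.+3 by rewrite /= -/l; lia.
    have RB := reach_const (etrans (congr1 (onth p) pc2) P4) (nfit 0 isT).
    set m3 := Config _ _ _ in RB.
    have pc3 : pc m3 = l.+4 by rewrite /= -/l; lia.
    have RC := reach_arith (etrans (congr1 (onth p) pc3) P5) (b := b).
    rewrite /= /upd !regE /= ci in RC.
    have {}RC := RC (nfit _ (ltnW ltin)).
    set m4 := Config _ _ _ in RC.
    have Rep4 : represents (set_var t x i) m4.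
      refine (@represents_regs _ _ _ _ _ R1 _ _ _ _); rewrite /= /upd ?regE // => y.
      by rewrite !regE (rep_var R1) add0n; case: (y == x).
    have bt4 : bounded (set_var t x i).
      apply: bounded_set_var => //; apply: ltn_powW dx1 _; rewrite expn1.
      exact: ltn_trans n_ltX.
    have C6' : code_at (pc m4) (compile c (pc m4) d.+1).
      rewrite (_ : pc m4 = l + 5); last by rewrite /= -/l; lia.
      by move: C6; rewrite -/l (_ : l.+4.+1 = l + 5); last lia.
    have [bt5 [m5 [RD pc5 Rep5 K5]]] := IH d.+1 _ m4 bt4 Rep4 fc C6'.
    have pc5' : pc m5 = l.+4.+1 + csize c by rewrite pc5 /= -/l; lia.
    have c5 : reg m5 (rctr d) = i by rewrite K5 //= !regE.
    have one : 1 < 2 ^ b by apply: (@word_fits _ 1); [lia|rewrite expn1].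
    have RE := reach_const (etrans (congr1 (onth p) pc5') P7) one.
    set m6 := Config _ _ _ in RE.
    have pc6 : pc m6 = (l.+4.+1 + csize c).+1 by rewrite /= pc5'.
    have RF := reach_arith (etrans (congr1 (onth p) pc6) P8) (b := b).
    rewrite /= /upd !regE /= c5 in RF.
    have {}RF := RF (nfit _ (eq_ind _ (fun z => z <= n) ltin _ (esym (addn1 i)))).
    set m7 := Config _ _ _ in RF.
    have pc7 : pc m7 = (l.+4.+1 + csize c).+2 by rewrite /= pc5'.
    have RG := @reach_step b p _ _ _ (etrans (congr1 (onth p) pc7) P9) erefl.
    set m8 := Config _ _ _ in RG.
    have Rep8 : represents (exec n inp c (set_var t x i)) m8.
      refine (@represents_regs _ _ _ _ _ Rep5 _ _ _ _); rewrite /= /upd ?regE // => y.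
      by rewrite !regE (rep_var Rep5).
    have [||||bt9 [m9 [RH pc9 Rep9 K9]]] := IHr i.+1 _ m8 _ bt5 Rep8; try by rewrite /= ?regE; lia.
      move=> d' dd'; rewrite /= !regE (_ : d' == d = false); last by lia.
      rewrite K5; last by lia.
      by rewrite /= !regE K1.
    split=> //; exists m9; split=> //.
    apply: reach_leq (reach_trans RA (reach_trans RB (reach_trans RC
      (reach_trans RD (reach_trans RE (reach_trans RF (reach_trans RG RH))))))).
    by rewrite /T; lia.
  have RA := reach_const P1 (nfit 0 isT).
  set m1 := Config _ _ _ in RA.
  have Rep1 : represents s m1.
    refine (@represents_regs _ _ _ _ _ R _ _ _ _); rewrite /= /upd ?regE // => y.
    by rewrite !regE (rep_var R).
  have [||bt [m2 [RB pc2 Rep2 K2]]] := loop n 0 s m1 (add0n n) bs Rep1 erefl.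
  + by rewrite /= /upd eqxx.
  + by move=> d' dd'; rewrite /= /upd regE (_ : d' == d = false) //; lia.
  split=> //; exists m2; split=> //.
  apply: reach_leq (reach_trans RA RB); rewrite /T expnS.
  by have := npow (depth c); nia.
Qed.

End Compiler.

(** * Leaf elimination *)

(** The leaf is an end [x] of a longest simple path inside [S]. A neighbor of [x] in [S] off the
    path would prolong it, and one on the path other than the successor [y] would close a cycle. *)
Lemma acyclic_leaf (T : finType) (e : rel T) (S : pred T) :
  symmetric e -> irreflexive e -> (forall s, ucycle e s -> size s <= 2) ->
  forall x y, S x -> S y -> e x y ->
  exists x y, [/\ S x, S y, e x y & forall z, S z -> e x z -> z = y].
Proof.
move=> esym eirr acyc x0 y0 Sx0 Sy0 exy0.
pose eS := [rel x y | [&& S x, S y & e x y]].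
pose P k := [exists s : k.-tuple T, uniq s && sorted eS s].
have P2 : P 2.
  apply/existsP; exists [tuple x0; y0]; rewrite /= !inE Sx0 Sy0 exy0 !andbT.
  by apply: contraTneq exy0 => ->; rewrite eirr.
have Pmax k : P k -> k <= #|T|.
  by case/existsP => s /andP[us _]; rewrite -(size_tuple s) -(card_uniqP us) max_card.
have [k Pk kmax] := ex_maxnP (ex_intro P 2 P2) Pmax.
case/existsP: Pk => -[s /= /eqP sk] /andP[us ps].
have := kmax _ P2; rewrite -sk.
case: s sk us ps => [|x [|y q]] // sk us ps _.
have /and3P[Sx Sy exy] : eS x y by case/andP: ps.
exists x, y; split=> // z Sz exz.
have zs : z \in x :: y :: q.
  apply: contraT => zs; have : P k.+1; last by move/kmax; rewrite ltnn.
  have sk1 : size (z :: x :: y :: q) == k.+1 by rewrite /= -sk.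
  apply/existsP; exists (Tuple sk1); rewrite [val _]/= cons_uniq zs us /=.
  by move: ps; rewrite Sz [e z x]esym exz /= Sx.
move: zs; rewrite !inE => /or3P[/eqP zx|/eqP //|zq].
  by rewrite zx eirr in exz.
move: us ps; case/splitPr: zq => q1 q2 us ps.
(* The segment from [x] to [z], closed by the edge between them; it has at least three vertices. *)
have cyc : ucycle e (x :: y :: rcons q1 z).
  apply/andP; split.
    rewrite /= exy /= rcons_path last_rcons [e z x]esym exz andbT.
    have : path eS y (q1 ++ z :: q2) by case/andP: ps.
    rewrite -cat_rcons cat_path => /andP[+ _].
    by apply: sub_path => a b /and3P[].
  by move: us; rewrite -!cat_cons -cat_rcons cat_uniq => /and3P[].
by move/acyc: cyc; rewrite /= size_rcons.
Qed.

(** A vertex [v] takes a state [(c v, t v)]: its color and the maximal color of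
    its bundle, both counted from 0. *)
Section MinSum.
Variables (n INF : nat) (E : rel nat) (bun : nat -> nat).

Definition compatible (u v c t d q : nat) : bool :=
  (c != d) && ((bun u == bun v) ==> (t == q)).

Definition feasible (S : pred nat) (A : nat -> nat -> nat -> nat) (m : nat) : Prop :=
  exists c t : nat -> nat,
  [/\ forall v, v < n -> c v < n /\ t v < n,
      forall u v, u < n -> v < n -> S u -> S v -> E u v ->
        compatible u v (c u) (t u) (c v) (t v) &
      \sum_(v < n | S v) A v (c v) (t v) <= m].

Hypothesis E_sym : forall u v, u < n -> v < n -> E u v = E v u.

Lemma compatibleC u v c t d q : compatible u v c t d q = compatible v u d q c t.
Proof. by rewrite /compatible eq_sym [bun u == _]eq_sym [t == _]eq_sym. Qed.

Lemma feasible_eq (S S' : pred nat) A A' m :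
  (forall v, v < n -> S v = S' v) ->
  (forall v c t, v < n -> c < n -> t < n -> S v -> A v c t = A' v c t) ->
  feasible S A m -> feasible S' A' m.
Proof.
move=> SS AA [c [t [Hb He Hs]]]; exists c, t; split=> //.
  by move=> u v un vn; rewrite -!SS //; apply: He.
apply: leq_trans Hs; apply: eq_leq; apply: eq_big => v; first by rewrite SS.
by rewrite -SS // => Sv; have [? ?] := Hb v (ltn_ord v); rewrite AA.
Qed.

Lemma sum_split (S : pred nat) (F : nat -> nat) v : v < n -> S v ->
  \sum_(w < n | S w) F w = F v + \sum_(w < n | S w && (val w != v)) F w.
Proof. by move=> vn Sv; rewrite (bigD1 (Ordinal vn)). Qed.

(** As [u] is the only neighbor of [v] in [S], the best state of [v] depends on the state of [u]
    alone: an assignment of the rest extends by a minimizer, and conversely [bst] bounds from below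
    what [v] pays. The cut at [INF] is invisible to thresholds below [INF]. *)
Lemma feasible_eliminate (S : pred nat) (A A' : nat -> nat -> nat -> nat) bst u v m :
  u < n -> v < n -> S u -> S v -> u != v ->
  (forall w, w < n -> S w -> E v w -> w = u) -> E v u ->
  (forall c t m, c < n -> t < n -> m < INF -> bst c t <= m <->
     exists d q, [/\ d < n, q < n, compatible u v c t d q & A v d q <= m]) ->
  (forall c t, c < n -> t < n -> A' u c t = minn INF (A u c t + bst c t)) ->
  (forall w c t, w < n -> c < n -> t < n -> w != u -> A' w c t = A w c t) ->
  m < INF ->
  feasible (fun w => S w && (w != v)) A' m <-> feasible S A m.
Proof.
move=> un vn Su Sv uv leaf Evu bstP A'u A'w ltm.
have vu : (v == u) = false by rewrite eq_sym (negbTE uv).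
have rest c t : (forall v, v < n -> c v < n /\ t v < n) ->
  \sum_(w < n | S w && (val w != v)) A' w (c w) (t w) =
  A' u (c u) (t u) + \sum_(w < n | S w && (val w != v) && (val w != u)) A w (c w) (t w).
  move=> Hb; apply: etrans
    (@sum_split (fun w => S w && (w != v)) (fun w => A' w (c w) (t w)) u un _) _.
    by rewrite Su uv.
  congr (_ + _).
  by apply: eq_bigr => w /andP[_ wu]; have [? ?] := Hb w (ltn_ord w); apply: A'w.
have rest2 (c t : nat -> nat) :
  \sum_(w < n | S w) A w (c w) (t w) = A v (c v) (t v) + (A u (c u) (t u) +
    \sum_(w < n | S w && (val w != v) && (val w != u)) A w (c w) (t w)).
  apply: etrans (@sum_split S (fun w => A w (c w) (t w)) v vn Sv) _; congr (_ + _).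
  apply: (@sum_split (fun w => S w && (w != v)) (fun w => A w (c w) (t w)) u un).
  by rewrite Su uv.
split=> -[c [t [Hb He Hs]]].
- have [cu tu] := Hb u un.
  rewrite rest // A'u // in Hs.
  (* The capped cost of [u] is at most [m < INF], so the cap was not reached and [bstP] can be used
     at the threshold [bst] itself, which yields a minimizer. *)
  have bI : bst (c u) (t u) < INF by lia.
  have [d [q [dn qn cpt le]]] := (bstP _ _ _ cu tu bI).1 (leqnn _).
  exists (upd c v d), (upd t v q); split.
  + by move=> w wn; rewrite /upd; case: eqP => // _; apply: Hb.
  + move=> w1 w2 w1n w2n S1 S2 E12; rewrite /upd.
    case: (altP (w1 =P v)) => [e1|n1]; case: (altP (w2 =P v)) => [e2|n2].
    * by move: E12; rewrite e1 e2 => /(leaf v vn Sv)/eqP; rewrite vu.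
    * by move: E12; rewrite e1 => /(leaf w2 w2n S2) ->; rewrite compatibleC.
    * by move: E12; rewrite e2 E_sym // => /(leaf w1 w1n S1) ->.
    * by apply: He => //; rewrite ?S1 ?S2.
  + rewrite rest2 /upd eqxx (negbTE uv).
    set r := \sum_(w < n | _) _; set r' := \sum_(w < n | _) _ in Hs.
    have -> : r = r' by apply: eq_bigr => w /andP[/andP[_ /negbTE ->] _].
    lia.
- exists c, t; split=> //.
    by move=> w1 w2 w1n w2n /andP[S1 _] /andP[S2 _]; apply: He.
  have [cu tu] := Hb u un; have [cv tv] := Hb v vn.
  rewrite rest2 in Hs; rewrite rest // A'u //.
  have : bst (c u) (t u) <= A v (c v) (t v).
    apply/(bstP _ _ _ cu tu); first lia.
    exists (c v), (t v); split=> //; rewrite compatibleC; exact: He.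
  lia.
Qed.

(** Without edges the state of [v] is chosen independently of the others, so the two minima [a] and
    [b] add up. *)
Lemma feasible_isolated (S : pred nat) A a b v m :
  v < n -> ~~ S v ->
  (forall x y, x < n -> y < n -> S x || (x == v) -> S y || (y == v) -> ~~ E x y) ->
  (forall m, m < INF -> b <= m <-> exists d q, [/\ d < n, q < n & A v d q <= m]) ->
  (forall m, m < INF -> a <= m <-> feasible S A m) ->
  m < INF ->
  minn INF (a + b) <= m <-> feasible (fun w => S w || (w == v)) A m.
Proof.
move=> vn Sv noE bP aP ltm.
have split_sum (c t : nat -> nat) : \sum_(w < n | S w || (val w == v)) A w (c w) (t w) =
    A v (c v) (t v) + \sum_(w < n | S w) A w (c w) (t w).
  apply: etrans (@sum_split (fun w => S w || (w == v)) (fun w => A w (c w) (t w)) v vn _) _.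
    by rewrite eqxx orbT.
  congr (_ + _); apply: eq_bigl => w /=; case: eqP => [->|]; rewrite ?(negbTE Sv) ?andbF ?orbF ?andbT //.
split.
- move=> le; have aI : a < INF by lia.
  have bI : b < INF by lia.
  have [d [q [dn qn leb]]] := (bP b bI).1 (leqnn _).
  have [c [t [Hb He Hs]]] := (aP a aI).1 (leqnn _).
  exists (upd c v d), (upd t v q); split.
  + by move=> w wn; rewrite /upd; case: eqP => // _; apply: Hb.
  + by move=> x y xn yn Sx Sy Exy; have := noE x y xn yn Sx Sy; rewrite Exy.
  + rewrite split_sum /upd eqxx.
    set r := \sum_(w < n | _) _; set r' := \sum_(w < n | _) _ in Hs.
    have -> : r = r' by apply: eq_bigr => w Sw; case: eqP => // wv; rewrite wv (negbTE Sv) in Sw.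
    lia.
- move=> [c [t [Hb He]]]; rewrite split_sum => Hs.
  have [cv tv] := Hb v vn.
  have : b <= A v (c v) (t v) by apply/bP; [lia|exists (c v), (t v)].
  have : a <= \sum_(w < n | S w) A w (c w) (t w).
    apply/aP; first lia; exists c, t; split=> // x y xn yn Sx Sy.
    by apply: He; rewrite // ?Sx ?Sy.
  lia.
Qed.

End MinSum.

(** * Colorings and feasible assignments *)

Lemma compress_coloring (I : instance) c : proper_coloring I c ->
  exists c', [/\ proper_coloring I c', forall v, c' v <= nvertices I & cost I c' <= cost I c].
Proof.
move=> [cpos cprop].
(* the rank of [c v] among the colors that are used *)
pose c' v := size [seq x <- undup (codom c) | x <= c v].
pose used v := [seq x <- undup (codom c) | x <= c v].
have used_uniq v : uniq (used v) by rewrite filter_uniq // undup_uniq.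
have usedE v x : (x \in used v) = (x <= c v) && (x \in codom c).
  by rewrite mem_filter mem_undup.
have mono u v : c u < c v -> c' u < c' v.
  move=> lt; apply: (@uniq_leq_size _ (c v :: used u)) => [|x].
    by rewrite /= used_uniq usedE leqNgt lt.
  by rewrite inE !usedE => /orP[/eqP ->|/andP[le ->]]; rewrite ?leqnn ?codom_f // andbT; lia.
(* Colors are positive, so the used colors up to [c v] lie among [1, ..., c v]. *)
have le_c v : c' v <= c v.
  rewrite -[c v](size_iota 1) -/(size (used v)); apply: uniq_leq_size => [|x]; first exact: used_uniq.
  rewrite usedE mem_iota => /andP[le /codomP[u xu]].
  by have := cpos u; rewrite -xu; lia.
exists c'; split.
- split=> [v|u v euv]; first by rewrite lt0n size_eq0 -has_filter; apply/hasP;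
    exists (c v); rewrite // mem_undup codom_f.
  by have := cprop u v euv; rewrite !neq_ltn => /orP[] /mono ->; rewrite ?orbT.
- move=> v; rewrite -[nvertices I]card_ord -(size_codom c).
  by apply: leq_trans (size_undup _); rewrite /c' size_filter count_size.
- apply: leq_sum => j _; rewrite leq_mul2l; apply/orP; right.
  apply/bigmax_leqP => v vj; apply: leq_trans (le_c v) _; exact: leq_bigmax_cond.
Qed.

Section Link.
Variables (I : instance) (INF : nat) (E : rel nat) (bun charge : nat -> nat).
Variable rep : 'I_(nbundles I) -> 'I_(nvertices I).
Notation n := (nvertices I).
Hypothesis EP : forall u v : 'I_n, E u v = edge u v.
Hypothesis bunP : forall j (v : 'I_n), v \in bundle j -> bun v = j.
Hypothesis repP : forall j, rep j \in bundle j.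
Hypothesis chargeP : forall v : 'I_n, charge v = \sum_(j | rep j == v) weight j.
Hypothesis conn : bundles_connected I.

(** The bound [c <= t] is enforced at every vertex, also at those with charge 0. States count colors
    from 0, whence [t.+1]. *)
Definition unary_cost v c t := if t < c then INF else minn INF (charge v * t.+1).

Lemma bunE (u v : 'I_n) j : u \in bundle j -> bun u = bun v -> v \in bundle j.
Proof.
move=> uj uv.
have : v \in \bigcup_j bundle j by rewrite bundle_cover inE.
case/bigcupP => j' _ vj'; suff -> : j = j' by [].
by apply: val_inj; rewrite /= -(bunP uj) -(bunP vj').
Qed.

Lemma sum_charge (F : nat -> nat) :
  \sum_(v < n) charge v * F v = \sum_j weight j * F (rep j).
Proof.
rewrite (eq_bigr (fun v : 'I_n => \sum_(j | rep j == v) weight j * F v)); last first.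
  by move=> v _; rewrite chargeP big_distrl.
rewrite (exchange_big_dep predT) //=; apply: eq_bigr => j _.
by rewrite (big_pred1 (rep j)) // => v; rewrite eq_sym.
Qed.

(** From left to right, [t] is constant on each bundle and bounds its colors, so the representative
    pays at least the cost of the bundle. From right to left, the compressed coloring fits in [n]
    colors, and [t] is the true maximum over the bundle. *)
Lemma feasible_coloring m : m < INF ->
  feasible n E bun predT unary_cost m <->
  exists c, proper_coloring I c /\ cost I c <= m.
Proof.
move=> ltm; split.
- move=> [c [t [Hb He Hs]]].
  have cost_lt (v : 'I_n) : unary_cost v (c v) (t v) <= m.
    by apply: leq_trans Hs; rewrite (bigD1 v) //= leq_addr.
  have ct (v : 'I_n) : c v <= t v.
    by have := cost_lt v; rewrite /unary_cost; case: ltnP => //; lia.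
  have costE (v : 'I_n) : unary_cost v (c v) (t v) = charge v * (t v).+1.
    by have := cost_lt v; rewrite /unary_cost ltnNge ct /=; lia.
  (* Connectedness of the bundle enters here: equality of [t] propagates along a path inside it. *)
  have tE j (u v : 'I_n) : u \in bundle j -> v \in bundle j -> t u = t v.
    move=> uj vj; have /connectP[p] := conn uj vj.
    elim: p u uj => [|w p IH] u uj /=; first by move=> _ ->.
    move=> /andP[/and3P[_ wj euw] pw lastv]; rewrite -(IH w wj pw lastv).
    have := He u w (ltn_ord _) (ltn_ord _) isT isT; rewrite EP => /(_ euw) /andP[_].
    by rewrite (bunP uj) (bunP wj) eqxx => /eqP.
  exists (fun v => (c v).+1); split.
    split=> // u v euv; have := He u v (ltn_ord _) (ltn_ord _) isT isT.
    by rewrite EP eqSS => /(_ euv) /andP[].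
  apply: leq_trans Hs; under [leqRHS]eq_bigr => v _ do rewrite costE.
  rewrite (sum_charge (fun v => (t v).+1)); apply: leq_sum => j _.
  rewrite leq_mul2l; apply/orP; right; apply/bigmax_leqP => v vj.
  by rewrite ltnS (tE j (rep j) v).
- move=> [c0 [c0p c0m]]; have [c [[cpos cprop] cn cost_le]] := compress_coloring c0p.
  (* The states built from [c] and [top] are predecessors, since they count from 0; positivity of
     [c] makes this faithful, and [c v <= n] keeps them below [n]. *)
  pose top (v : nat) := \max_(u < n | bun u == bun v) c u.
  pose cc v := if insub v is Some u then (c u).-1 else 0.
  have ccE (v : 'I_n) : cc v = (c v).-1 by rewrite /cc valK.
  have topn v : top v <= n by apply/bigmax_leqP.
  have ctop (v : 'I_n) : c v <= top v.
    by apply: (@leq_bigmax_cond _ (fun u : 'I_n => bun u == bun v) _ v).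
  exists cc, (fun v => (top v).-1); split.
  + move=> v vn; rewrite (ccE (Ordinal vn) : cc v = _).
    by have := cpos (Ordinal vn); have := cn (Ordinal vn); have := topn v; lia.
  + move=> u v un vn _ _; rewrite -[u]/(val (Ordinal un)) -[v]/(val (Ordinal vn)) EP => euv.
    rewrite /compatible !ccE; apply/andP; split.
      have := cprop _ _ euv; have := cpos (Ordinal un); have := cpos (Ordinal vn); lia.
    by apply/implyP => /eqP uv; rewrite /top uv.
  + apply: leq_trans (leq_trans cost_le c0m).
    apply: (@leq_trans (\sum_(v < n) charge v * top v)).
      apply: leq_sum => v _; rewrite /unary_cost ccE.
      have := ctop v; have := cpos v => cv ct.
      rewrite (_ : _ < _ = false); last by lia.
      by rewrite prednK ?geq_minr //; lia.
    rewrite sum_charge; apply: leq_sum => j _; rewrite leq_mul2l; apply/orP; right.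
    apply/bigmax_leqP => u /eqP uj; apply: leq_bigmax_cond.
    by apply: bunE (repP j) _; rewrite uj.
Qed.

End Link.

(** * The program *)

Notation vW := 0 (only parsing).
Notation vInf := 1 (only parsing).
Notation vJ := 2 (only parsing).
Notation vV := 3 (only parsing).
Notation vLast := 4 (only parsing).
Notation vC := 5 (only parsing).
Notation vT := 6 (only parsing).
Notation vR := 7 (only parsing).
Notation vU := 8 (only parsing).
Notation vDeg := 9 (only parsing).
Notation vTmp := 10 (only parsing).
Notation vLeaf := 11 (only parsing).
Notation vNbr := 12 (only parsing).
Notation vBest := 13 (only parsing).
Notation vD := 14 (only parsing).
Notation vQ := 15 (only parsing).
Notation vAns := 16 (only parsing).
Notation vYes := 17 (only parsing).

Notation aBun := 0 (only parsing).
Notation aCharge := 1 (only parsing).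
Notation aDead := 2 (only parsing).
Notation aCost := 3 (only parsing).

Notation eadd := (EBin Add).
Notation esub := (EBin Sub).
Notation emul := (EBin Mul).
Notation emin e1 e2 := (esub e1 (esub e1 e2)).
Notation edist e1 e2 := (eadd (esub e1 e2) (esub e2 e1)).
Notation If0Lt e c := (IfLt (ECst 0) e c Skip).

Definition ecell x c t : expr :=
  eadd (emul (eadd (emul (EVar x) ENum) (EVar c)) ENum) (EVar t).
Definition ecost x c t : expr := EArr aCost (ecell x c t).
Definition enbundles : expr := EInp (ECst 1).
Definition eedge x y : expr :=
  EInp (eadd (eadd (ECst 3) (emul (EVar x) ENum)) (EVar y)).
Definition emember : expr :=
  EInp (eadd (eadd (eadd (ECst 3) (emul ENum ENum)) (emul (EVar vJ) ENum)) (EVar vV)).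
Definition eweight : expr :=
  EInp (eadd (eadd (eadd (ECst 3) (emul ENum ENum)) (emul enbundles ENum)) (EVar vJ)).
Definition ealive x : expr := esub (ECst 1) (EArr aDead (EVar x)).

Definition scan_bundle : cmd :=
  For vV (If0Lt emember (Seq (Store aBun (EVar vV) (EVar vJ)) (Assign vLast (EVar vV)))).

(** A loop of [n] rounds reaches all bundles because there are at most [n] of them. The charge is
    overwritten instead of accumulated, since disjoint bundles have distinct last vertices. [vW]
    becomes an upper bound of the weights. *)
Definition read_bundles : cmd :=
  For vJ (IfLt (EVar vJ) enbundles
    (Seq scan_bundle
    (Seq (Store aCharge (EVar vLast) eweight)
         (IfLt (EVar vW) eweight (Assign vW eweight) Skip))) Skip).

(** The coloring that numbers the vertices from 1 to [n] is proper and costs at most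
    [n * nbundles * vW], so the optimum is below this value. *)
Definition set_inf : cmd :=
  Assign vInf (eadd (emul (emul ENum enbundles) (EVar vW)) (ECst 1)).

Definition init_cell : cmd :=
  IfLt (EVar vT) (EVar vC) (Store aCost (ecell vV vC vT) (EVar vInf))
    (Store aCost (ecell vV vC vT)
       (emin (EVar vInf)
          (emul (EArr aCharge (EVar vV)) (eadd (EVar vT) (ECst 1))))).

Definition init_costs : cmd := For vV (For vC (For vT init_cell)).

Definition min_costs x g : cmd :=
  For vD (For vQ (If0Lt g (Assign vBest (emin (EVar vBest) (ecost x vD vQ))))).

Definition scan_nbrs : cmd :=
  For vU (If0Lt (emul (ealive vU) (eedge vV vU))
    (Seq (Assign vDeg (emin (ECst 2) (eadd (EVar vDeg) (ECst 1))))
         (Assign vTmp (EVar vU)))).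

(** The value [n] of [vLeaf] signals that there is no leaf; otherwise the last leaf found is
    kept. *)
Definition find_leaf : cmd :=
  Seq (Assign vLeaf ENum)
    (For vV (If0Lt (ealive vV)
       (Seq (Assign vDeg (ECst 0))
       (Seq scan_nbrs
            (* [vDeg] is the degree capped at 2 *)
            (If0Lt (emul (EVar vDeg) (esub (ECst 2) (EVar vDeg)))
               (Seq (Assign vLeaf (EVar vV)) (Assign vNbr (EVar vTmp)))))))).

(* positive if and only if the two states are compatible *)
Definition ecompat : expr :=
  emul (edist (EVar vC) (EVar vD))
    (esub (ECst 1) (emul (edist (EVar vT) (EVar vQ))
       (esub (ECst 1) (edist (EArr aBun (EVar vNbr)) (EArr aBun (EVar vLeaf)))))).

Definition update_cell : cmd :=
  Seq (Assign vBest (EVar vInf))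
  (Seq (min_costs vLeaf ecompat)
       (Store aCost (ecell vNbr vC vT)
          (emin (EVar vInf) (eadd (ecost vNbr vC vT) (EVar vBest))))).

Definition eliminate : cmd :=
  Seq find_leaf
    (IfLt (EVar vLeaf) ENum
       (Seq (For vC (For vT update_cell)) (Store aDead (EVar vLeaf) (ECst 1))) Skip).

Definition add_up : cmd :=
  For vV (If0Lt (ealive vV)
    (Seq (Assign vBest (EVar vInf))
    (Seq (min_costs vV (ECst 1))
         (Assign vAns (emin (EVar vInf) (eadd (EVar vAns) (EVar vBest))))))).

Definition decide : cmd :=
  Seq (Assign vYes (ECst 1)) (IfLt (EInp (ECst 2)) (EVar vAns) (Assign vYes (ECst 0)) Skip).

Definition algorithm : cmd :=
  Seq read_bundles (Seq set_inf (Seq init_costs (Seq (For vR eliminate) (Seq add_up decide)))).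

(* [vW] must be smaller than the others for [n * nbundles * vW + 1] to fit. *)
Definition dv x := if x is 0 then 1 else 5.

(** The largest exponent met is 15, for the address of a cost cell: [ecell] has exponent 9 and the
    address computation adds 6. The exponent 5 of the variables and arrays leaves room for [vInf],
    whose expression has exponent 4. *)
Lemma algorithm_fits : fits 20 5 dv algorithm.
Proof. by vm_compute. Qed.

Lemma depth_algorithm : depth algorithm = 5.
Proof. by vm_compute. Qed.

Arguments exec : simpl never.

(** * Correctness of the loop program *)

Section Correctness.
Variables (n : nat) (inp : seq nat).

Notation eval := (eval n inp).
Notation exec := (exec n inp).

Lemma exec_skip s : exec Skip s = s.
Proof. by []. Qed.

Lemma exec_assign x e s : exec (Assign x e) s = set_var s x (eval s e).
Proof. by []. Qed.

Lemma exec_store a e1 e2 s :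
  exec (Store a e1 e2) s = set_arr s a (eval s e1) (eval s e2).
Proof. by []. Qed.

Lemma exec_seq c1 c2 s : exec (Seq c1 c2) s = exec c2 (exec c1 s).
Proof. by []. Qed.

Lemma exec_if e1 e2 c1 c2 s : exec (IfLt e1 e2 c1 c2) s =
  if eval s e1 < eval s e2 then exec c1 s else exec c2 s.
Proof. by []. Qed.

Definition execE := (exec_skip, exec_assign, exec_store, exec_seq, exec_if).

(** Loop invariants need to mention only what the body changes; the rest is preserved by the
    syntactic write sets. *)
Lemma exec_for_frame (P : nat -> state -> Prop) x c s0 :
  P 0 s0 ->
  (forall i s, i < n ->
     (forall y, y \notin x :: wvars c -> var s y = var s0 y) ->
     (forall a, a \notin warrs c -> arr s a = arr s0 a) ->
     P i s -> P i.+1 (exec c (set_var s x i))) ->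
  P n (exec (For x c) s0).
Proof.
move=> P0 PS.
pose P' i s := [/\ P i s, forall y, y \notin x :: wvars c -> var s y = var s0 y &
  forall a, a \notin warrs c -> arr s a = arr s0 a].
suff [] : P' n (exec (For x c) s0) by [].
apply: exec_for_ind => // i s ltin [Pi Fv Fa]; split; first exact: PS.
- move=> y yxc; have yc : y \notin wvars c by move: yxc; rewrite inE negb_or => /andP[].
  rewrite exec_var // -Fv //= /upd; case: eqP yxc => // ->.
  by rewrite inE eqxx.
- by move=> a ac; rewrite exec_arr // -Fa.
Qed.

Definition cell v c t := (v * n + c) * n + t.

Lemma cell_eq v c t v' c' t' : c < n -> t < n -> c' < n -> t' < n ->
  (cell v c t == cell v' c' t') = [&& v == v', c == c' & t == t'].
Proof.
have pair_eq a b a' b' : b < n -> b' < n -> a * n + b = a' * n + b' -> a = a' /\ b = b'.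
  move=> bn bn' E; have n0 : 0 < n by lia.
  have := congr1 (divn^~ n) E; rewrite /= !divnMDl // !divn_small // !addn0 => Ea.
  by split=> //; move: E; rewrite Ea => /addnI.
move=> cn tn cn' tn'; apply/eqP/and3P => [E|[/eqP-> /eqP-> /eqP->] //].
have [E1 ->] := pair_eq _ _ _ _ tn tn' E.
by have [-> ->] := pair_eq _ _ _ _ cn cn' E1.
Qed.

Definition costs (s : state) v c t := arr s aCost (cell v c t).
(** Written exactly as the guard [ealive] evaluates, so that the two are convertible. *)
Definition alive (s : state) : pred nat := fun v => 0 < 1 - arr s aDead v.

Arguments cell : simpl never.
Arguments costs : simpl never.
Arguments alive : simpl never.

Lemma costs_set_var s x i : costs (set_var s x i) = costs s.
Proof. by []. Qed.

Lemma costs_set_arr s v c t x v' c' t' : c < n -> t < n -> c' < n -> t' < n ->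
  costs (set_arr s aCost (cell v c t) x) v' c' t' =
    if [&& v' == v, c' == c & t' == t] then x else costs s v' c' t'.
Proof. by move=> *; rewrite -cell_eq. Qed.

(** Each cell of the plane [x] is visited once, so the body finds the original value there, and it
    may read other planes, which do not change. This serves both the initial costs and the update at
    the neighbor of a leaf. *)
Lemma fill_plane x body (F : nat -> nat -> nat -> nat) s0 :
  vC \notin wvars body -> vT \notin wvars body ->
  (forall s c t, c < n -> t < n -> var s vC = c -> var s vT = t ->
     (forall y, y \notin [:: vC, vT & wvars body] -> var s y = var s0 y) ->
     (forall a, a \notin warrs body -> arr s a = arr s0 a) ->
     (forall v c t, c < n -> t < n -> v != x -> costs s v c t = costs s0 v c t) ->
     forall v' c' t', c' < n -> t' < n ->
     costs (exec body s) v' c' t' =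
       if [&& v' == x, c' == c & t' == t] then F c t (costs s x c t) else costs s v' c' t') ->
  forall v c t, c < n -> t < n ->
  costs (exec (For vC (For vT body)) s0) v c t =
    if v == x then F c t (costs s0 x c t) else costs s0 v c t.
Proof.
move=> bC bT Hbody.
pose P i s := forall v c t, c < n -> t < n -> costs s v c t =
    if (v == x) && (c < i) then F c t (costs s0 x c t) else costs s0 v c t.
suff H : P n (exec (For vC (For vT body)) s0).
  by move=> v c t cn tn; rewrite H // cn andbT.
apply: exec_for_frame => [v c t _ _|i s ltin Fv Fa Pi]; first by rewrite andbF.
set s1 := set_var s vC i.
pose P2 j s' := forall v c t, c < n -> t < n -> costs s' v c t =
  if [&& v == x, c == i & t < j] then F c t (costs s x c t) else costs s v c t.
have H : P2 n (exec (For vT body) s1).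
  apply: exec_for_frame => [v c t _ _|j s' ltjn Fv' Fa' Pj]; first by rewrite !andbF.
  move=> v c t cn tn; rewrite (Hbody _ i j) //=.
  - rewrite !costs_set_var !Pj // !ltnn !andbF ltnS [t <= j]leq_eqVlt.
    case: (altP (v =P x)) => //= vx; case: (altP (c =P i)) => //= ci.
    by case: (altP (t =P j)) => //= tj; rewrite ci tj.
  - have -> : upd (var s') vT j vC = var s' vC by [].
    by rewrite Fv' // inE negb_or bC.
  - move=> y; rewrite !inE !negb_or => /and3P[yC yT yb].
    rewrite /upd (negbTE yT) Fv' /s1 /=; last by rewrite inE negb_or yT yb.
    by rewrite /upd (negbTE yC) Fv // !inE !negb_or yC yT yb.
  - by move=> a ab; rewrite Fa' // Fa.
  - move=> v' c' t' cn' tn' vx; rewrite costs_set_var Pj // (negbTE vx) /=.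
    by rewrite Pi // (negbTE vx).
move=> v c t cn tn; rewrite H // !Pi // ltnS tn andbT eqxx /= [c <= i]leq_eqVlt.
case: (altP (v =P x)) => //= vx; case: (altP (c =P i)) => //= ci.
by rewrite ci ltnn.
Qed.

(** The minimum is described by the thresholds above it, the form in which the elimination lemmas
    consume it; the initial value of [vBest] is one of the candidates. *)
Lemma min_costsP x g (G : nat -> nat -> bool) s0 v m :
  x \notin [:: vD; vQ; vBest] -> var s0 x = v ->
  (forall s, (forall y, y \notin [:: vD; vQ; vBest] -> var s y = var s0 y) ->
     (forall a, arr s a = arr s0 a) -> (0 < eval s g) = G (var s vD) (var s vQ)) ->
  var (exec (min_costs x g) s0) vBest <= m <->
  var s0 vBest <= m \/
  exists d q, [/\ d < n, q < n, G d q & costs s0 v d q <= m].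
Proof.
move=> xn xv HG.
pose P i s := var s vBest <= m <->
  var s0 vBest <= m \/ exists d q, [/\ d < i, q < n, G d q & costs s0 v d q <= m].
apply: (@exec_for_frame P) => [|i s ltin Fv Fa Pi].
  by split=> [|[|[d [q []]]]]; auto.
set s1 := set_var s vD i.
pose P2 j s' := var s' vBest <= m <->
  var s vBest <= m \/ exists q, [/\ q < j, G i q & costs s0 v i q <= m].
have H : P2 n (exec (For vQ (If0Lt g (Assign vBest (emin (EVar vBest) (ecost x vD vQ))))) s1).
  apply: exec_for_frame => [|j s' ltjn Fv' Fa' Pj].
    by split=> [|[|[q []]]]; auto.
  have xF : var s' x = v.
    move: xn; rewrite !inE !negb_or => /and3P[x1 x2 x3].
    rewrite Fv' ?inE ?negb_or ?x2 // /s1 /= /upd (negbTE x1) Fv ?xv //.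
    by rewrite !inE !negb_or x1 x2.
  have EG : (0 < eval (set_var s' vQ j) g) = G i j.
    rewrite HG.
    - congr G; rewrite /set_var /upd /= Fv' //.
    - move=> y; rewrite !inE !negb_or => /and3P[y1 y2 y3].
      rewrite /= /upd (negbTE y2) Fv' ?inE ?negb_or ?y2 // /s1 /= /upd (negbTE y1) Fv //.
      by rewrite !inE !negb_or y1 y2.
    - by move=> a; rewrite /= Fa' // Fa.
  have Ecell : arr s' aCost ((var s' x * n + i) * n + j) = costs s0 v i j.
    by rewrite xF /costs /cell Fa' // Fa.
  rewrite /P2 !execE /= EG; case: ifP => Gij; last first.
    split=> [/Pj|] [le|[q [qj Gq le]]]; [by left|right|apply/Pj; by left|apply/Pj; right].
      by exists q; split=> //; lia.
    exists q; split=> //; move: qj; rewrite ltnS leq_eqVlt => /orP[/eqP E|//].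
    by rewrite E Gij in Gq.
  have xQ : x == vQ = false by move: xn; rewrite !inE !negb_or => /and3P[_ /negbTE].
  rewrite /= /upd /= xQ (Fv' vD) // [var s1 vD]/= Ecell -minnE geq_min; split.
    case/orP => [/Pj [le|[q [qj Gq le]]]|le]; [by left|right|right].
      by exists q; split=> //; lia.
    by exists j; split.
  move=> [le|[q [qj Gq le]]]; first by rewrite (Pj.2 (or_introl le)).
  move: qj; rewrite ltnS leq_eqVlt => /orP[/eqP E|qj']; first by rewrite -E le orbT.
  by apply/orP; left; apply/Pj; right; exists q.
split.
  move=> /H[/Pi [le|[d [q [di qn Gq le]]]]|[q [qn Gq le]]]; [by left|right|right].
    by exists d, q; split=> //; lia.
  by exists i, q; split.
move=> [le|[d [q [di qn Gq le]]]]; apply/H; first by left; apply/Pi; left.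
move: di; rewrite ltnS leq_eqVlt => /orP[/eqP E|di']; first by right; exists q; rewrite -E.
by left; apply/Pi; right; exists d, q.
Qed.

(** * Detection of leaves *)

Definition adj : rel nat := fun u v => 0 < nth 0 inp (3 + u * n + v).
Definition nbr (s : state) v : pred nat := fun u => alive s u && adj v u.

Lemma alive_frame s s' : arr s aDead = arr s' aDead -> alive s = alive s'.
Proof. by rewrite /alive => ->. Qed.

Definition unique_nbr s v u :=
  [/\ u < n, nbr s v u & forall w, w < n -> nbr s v w -> w = u].

Lemma scan_nbrsP s0 v : var s0 vV = v -> var s0 vDeg = 0 ->
  let s := exec scan_nbrs s0 in
  [\/ var s vDeg = 0 /\ (forall u, u < n -> ~~ nbr s0 v u),
      var s vDeg = 1 /\ unique_nbr s0 v (var s vTmp) |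
      var s vDeg = 2 /\ (forall u, ~ unique_nbr s0 v u)].
Proof.
move=> Ev Ed s.
(* Once the capped degree is 2, two distinct neighbors are remembered: they refute uniqueness
   whatever the rest of the scan finds. *)
pose P i s := [\/ var s vDeg = 0 /\ (forall u, u < i -> ~~ nbr s0 v u),
  var s vDeg = 1 /\ [/\ var s vTmp < i, nbr s0 v (var s vTmp) &
    forall w, w < i -> nbr s0 v w -> w = var s vTmp] |
  var s vDeg = 2 /\ (exists x y, [/\ x < i, y < i, x != y, nbr s0 v x & nbr s0 v y])].
have : P n s; last first.
  case=> [[d H]|[d H]|[d [x [y [xn yn xy nx ny]]]]].
  - by constructor 1.
  - by constructor 2; split.
  - constructor 3; split=> // u [un _ H].
    by case/eqP: xy; rewrite (H x xn nx) (H y yn ny).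
rewrite /s; apply: exec_for_frame => [|i t ltin Fv Fa Pi]; first by constructor 1.
have E1 : var t vV = v by rewrite Fv.
have E2 : arr t aDead = arr s0 aDead by rewrite Fa.
have EG : (0 < (1 - arr t aDead i) * nth 0 inp (3 + var t vV * n + i)) = nbr s0 v i.
  by rewrite muln_gt0 E1 E2.
rewrite /P !execE /= EG; case: ifP => ni; rewrite /= /upd /=; last first.
  case: Pi => [[d H]|[d [H1 H2 H3]]|[d [x [y [xn yn xy nx ny]]]]].
  - constructor 1; split=> // u; rewrite ltnS leq_eqVlt => /orP[/eqP ->|/H //].
    by rewrite ni.
  - constructor 2; split=> //; split=> //; first lia.
    move=> w; rewrite ltnS leq_eqVlt => /orP[/eqP ->|/H3 //].
    by rewrite ni.
  - by constructor 3; split=> //; exists x, y; split=> //; lia.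
case: Pi => [[d H]|[d [H1 H2 H3]]|[d [x [y [xn yn xy nx ny]]]]]; rewrite d.
- constructor 2; split=> //; split=> // w.
  by rewrite ltnS leq_eqVlt => /orP[/eqP //|/H /negP].
- constructor 3; split=> //; exists (var t vTmp), i; split=> //; lia.
- by constructor 3; split=> //; exists x, y; split=> //; lia.
Qed.

Lemma find_leafP s0 :
  let s := exec find_leaf s0 in
  (var s vLeaf = n /\ forall v u, v < n -> alive s0 v -> ~ unique_nbr s0 v u) \/
  [/\ var s vLeaf < n, alive s0 (var s vLeaf) & unique_nbr s0 (var s vLeaf) (var s vNbr)].
Proof.
set s1 := set_var s0 vLeaf n.
pose P i s := (var s vLeaf = n /\ forall v u, v < i -> alive s0 v -> ~ unique_nbr s0 v u) \/
  [/\ var s vLeaf < n, alive s0 (var s vLeaf) & unique_nbr s0 (var s vLeaf) (var s vNbr)].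
suff : P n (exec (For vV (If0Lt (ealive vV)
       (Seq (Assign vDeg (ECst 0))
       (Seq scan_nbrs
            (If0Lt (emul (EVar vDeg) (esub (ECst 2) (EVar vDeg)))
               (Seq (Assign vLeaf (EVar vV)) (Assign vNbr (EVar vTmp)))))))) s1) by [].
apply: exec_for_frame => [|i s ltin Fv Fa Pi]; first by left.
have Fdead : arr s aDead = arr s0 aDead by rewrite Fa.
have Fal : alive s = alive s0 by apply: alive_frame.
rewrite exec_if [eval _ _]/= [eval _ _]/= [upd _ _ _ _]/= -/(alive s i) Fal.
case: ifP => ai; last first.
  case: Pi => [[d H]|H]; last by right.
  left; split=> // v u; rewrite ltnS leq_eqVlt => /orP[/eqP ->|vi]; last exact: H.
  by rewrite ai.
rewrite !exec_seq exec_assign [eval _ _]/=; set s2 := set_var (set_var s vV i) vDeg 0.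
have S := @scan_nbrsP s2 i erefl erefl.
have Fv3 y : y \notin [:: vU; vDeg; vTmp] -> var (exec scan_nbrs s2) y = var s2 y.
  by move=> yn; apply: exec_var.
set s3 := exec scan_nbrs s2 in S Fv3 *.
have E2 x y : unique_nbr s2 x y <-> unique_nbr s0 x y.
  by rewrite /unique_nbr /nbr /alive /s2 /= Fdead.
rewrite !execE /=.
have nochange : (forall u, ~ unique_nbr s0 i u) -> P i.+1 s3.
  move=> no; case: Pi => [[d H]|H].
    left; rewrite Fv3 //=; split=> // v u; rewrite ltnS leq_eqVlt => /orP[/eqP -> _|vi].
      exact: no.
    exact: H.
  by right; rewrite !Fv3.
case: S => [[-> H]|[-> H]|[-> H]] /=.
- apply: nochange => u [un nu _]; have := H u un.
  by move: nu; rewrite /nbr /alive /s2 /= Fdead => ->.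
- right; rewrite /= /upd /= Fv3 //=; split=> //.
  exact/E2.
- by apply: nochange => u /E2; apply: H.
Qed.

(** * Elimination rounds and the final sum *)

Section Elimination.
Variables (inf : nat) (bun : nat -> nat).

Definition leaf_min (A : nat -> nat -> nat -> nat) u v c t : nat :=
  \big[minn/inf]_(p : 'I_n * 'I_n | compatible bun u v c t p.1 p.2) A v p.1 p.2.

(** The start value [inf] is not neutral for [minn] on all of [nat], so the threshold is computed by
    induction on the list of states. *)
Lemma leaf_min_leq A u v c t m : leaf_min A u v c t <= m <->
  inf <= m \/ exists d q, [/\ d < n, q < n, compatible bun u v c t d q & A v d q <= m].
Proof.
have bigE (r : seq ('I_n * 'I_n)) :
  (\big[minn/inf]_(p <- r | compatible bun u v c t p.1 p.2) A v p.1 p.2 <= m) =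
  (inf <= m) || has (fun p : 'I_n * 'I_n => compatible bun u v c t p.1 p.2 && (A v p.1 p.2 <= m)) r.
  elim: r => [|p r IH]; first by rewrite big_nil orbF.
  rewrite big_cons /=; case: ifP => _ /=; last exact: IH.
  by rewrite geq_min IH orbCA.
rewrite /leaf_min bigE; split.
- case/orP => [|/hasP[[d q] _ /andP[cpt le]]]; [by left|right].
  by exists d, q; split.
- case=> [-> //|[d [q [dn qn cpt le]]]]; apply/orP; right; apply/hasP.
  by exists (Ordinal dn, Ordinal qn); rewrite ?mem_index_enum //= cpt.
Qed.

Lemma update_cellP s0 u v c t : c < n -> t < n -> var s0 vNbr = u -> var s0 vLeaf = v ->
  var s0 vC = c -> var s0 vT = t -> var s0 vInf = inf -> arr s0 aBun = bun ->
  forall v' c' t', c' < n -> t' < n ->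
  costs (exec update_cell s0) v' c' t' =
    if [&& v' == u, c' == c & t' == t]
    then minn inf (costs s0 u c t + leaf_min (costs s0) u v c t) else costs s0 v' c' t'.
Proof.
move=> cn tn Eu Ev Ec Et Ei Eb.
set s1 := set_var s0 vBest inf.
set s2 := exec (min_costs vLeaf ecompat) s1.
have Fv y : y \notin [:: vD; vQ; vBest] -> var s2 y = var s1 y.
  by move=> yn; apply: exec_var.
have Fa a : arr s2 a = arr s0 a by rewrite /s2 exec_arr.
(* Two numbers with the same upper thresholds are equal. *)
have bestE : var s2 vBest = leaf_min (costs s0) u v c t.
  have H m : var s2 vBest <= m <-> leaf_min (costs s0) u v c t <= m.
    apply: iff_trans (iff_sym (leaf_min_leq _ _ _ _ _ _)).
    apply: (@min_costsP vLeaf ecompat (compatible bun u v c t) s1 v m isT Ev).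
    move=> s Hv Ha; rewrite /= (Hv vC) // (Hv vT) // (Hv vNbr) // (Hv vLeaf) // !Ha.
    rewrite /= /upd /= Ec Et Eu Ev Eb /compatible.
    rewrite muln_gt0; congr (_ && _); first lia.
    rewrite subn_gt0 ltnS leqn0 muln_eq0.
    by case: (altP (bun u =P bun v)) => /= h; lia.
  by apply/eqP; rewrite eqn_leq (H _).2 // (H _).1.
move=> v' c' t' cn' tn'.
have -> : exec update_cell s0 = set_arr s2 aCost (cell u c t)
    (minn inf (costs s0 u c t + leaf_min (costs s0) u v c t)).
  rewrite /update_cell !exec_seq exec_assign [eval _ _]/= Ei -/s1 -/s2 exec_store /=.
  rewrite !(Fv vNbr) // !(Fv vC) // !(Fv vT) // !(Fv vInf) // !Fa /= /upd /= Eu Ec Et Ei bestE.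
  by rewrite -minnE.
by rewrite costs_set_arr // /costs Fa.
Qed.

Hypothesis adj_sym : forall u v, u < n -> v < n -> adj u v = adj v u.
Hypothesis adj_irr : forall u, u < n -> adj u u = false.

(** The second half of the conclusion measures progress for the count of rounds: either no leaf
    exists, or the number of surviving vertices drops. *)
Lemma eliminateP s0 : var s0 vInf = inf -> arr s0 aBun = bun ->
  let s := exec eliminate s0 in
  (forall m, m < inf -> feasible n adj bun (alive s) (costs s) m <->
                        feasible n adj bun (alive s0) (costs s0) m) /\
  ((forall v u, v < n -> alive s0 v -> ~ unique_nbr s0 v u) /\ alive s = alive s0 \/
   (exists v u, [/\ v < n, alive s0 v & unique_nbr s0 v u]) /\
   count (alive s) (iota 0 n) < count (alive s0) (iota 0 n)).
Proof.
move=> Ei Eb; rewrite /eliminate exec_seq exec_if [eval _ _]/= [eval _ _]/=.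
have Fa a : arr (exec find_leaf s0) a = arr s0 a by rewrite exec_arr.
have Ei1 : var (exec find_leaf s0) vInf = inf by rewrite exec_var.
have costs1 : costs (exec find_leaf s0) = costs s0 by rewrite /costs Fa.
have alive1 : alive (exec find_leaf s0) = alive s0 by rewrite /alive Fa.
case: (find_leafP s0) => [[Ev noleaf]|[]].
  by rewrite Ev ltnn exec_skip /= costs1 alive1; split=> //; left.
move: costs1 alive1 Ei1 Fa; set s1 := exec find_leaf s0 => costs1 alive1 Ei1 Fa vn av leaf.
rewrite vn; set v := var s1 vLeaf in vn av leaf *; set u := var s1 vNbr in leaf *.
have [un /andP[au Evu] uniq_u] := leaf.
have uv : u != v by apply: contraTneq Evu => ->; rewrite adj_irr.
set s2 := exec (For vC (For vT update_cell)) s1.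
have Fv2 y : y \notin [:: vC; vT; vBest; vD; vQ] -> var s2 y = var s1 y.
  move=> yn; apply: exec_var; move: yn; rewrite /= !inE !negb_or.
  by move=> /and5P[-> -> -> -> ->].
have dead2 : arr s2 aDead = arr s0 aDead by rewrite /s2 exec_arr.
have cost2 v' c t : c < n -> t < n -> costs s2 v' c t =
    if v' == u then minn inf (costs s0 u c t + leaf_min (costs s0) u v c t) else costs s0 v' c t.
  move=> cn tn; rewrite -costs1.
  apply: (@fill_plane u update_cell
    (fun c t x => minn inf (x + leaf_min (costs s1) u v c t))) => //.
  move=> s c0 t0 c0n t0n Hc Ht Hv Ha Hcost v1 c1 t1 c1n t1n.
  rewrite (@update_cellP s u v c0 t0 c0n t0n (Hv vNbr isT) (Hv vLeaf isT) Hc Ht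
    (etrans (Hv vInf isT) Ei1) (etrans (Ha aBun isT) (etrans (Fa aBun) Eb))) //.
  case: ifP => // _; congr (minn _ (_ + _)).
  (* The costs of the leaf [v] are intact while those of [u] are being overwritten, because
     [u != v]. *)
  by apply: eq_bigr => p _; apply: Hcost => //; rewrite eq_sym.
rewrite !execE /= Fv2 // -/v; set s3 := set_arr _ _ _ _.
have alive3 w : alive s3 w = alive s0 w && (w != v).
  by rewrite /alive /s3 /= /upd dead2; case: eqP => _; rewrite ?andbT ?andbF.
split.
  move=> m ltm.
  have := @feasible_eliminate n inf adj bun adj_sym (alive s0) (costs s0) (costs s3)
    (leaf_min (costs s0) u v) u v m un vn au av uv.
  case=> //.
  - by move=> w wn aw Evw; apply: uniq_u => //; apply/andP.
  - move=> c t m' cn tn ltm'; apply: iff_trans (leaf_min_leq _ _ _ _ _ _) _.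
    by split=> [[|//]|H]; [lia|right].
  - by move=> c t cn tn; rewrite -[costs s3 _ _ _]/(costs s2 u c t) cost2 ?eqxx.
  - by move=> w c t wn cn tn wu; rewrite -[costs s3 _ _ _]/(costs s2 w c t) cost2 ?(negbTE wu).
  move=> H1 H2; split.
    by move=> H; apply: H1; apply: feasible_eq H => // w _; rewrite alive3.
  by move=> /H2 H; apply: feasible_eq H => // w _; rewrite alive3.
right; split; first by exists v, u; split.
rewrite -!size_filter.
apply: (@uniq_leq_size _ (v :: [seq x <- iota 0 n | alive s3 x])) => [|x].
  by rewrite /= mem_filter alive3 eqxx andbF filter_uniq ?iota_uniq.
rewrite inE !mem_filter mem_iota alive3 /= add0n.
by case/orP => [/eqP ->|/andP[/andP[-> _] ->]]; rewrite ?av ?vn.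
Qed.

Hypothesis has_leaf : forall S : pred nat,
  (exists u v, [/\ u < n, v < n, S u, S v & adj u v]) ->
  exists v u, [/\ v < n, u < n, S v & S u && adj v u] /\
    forall w, w < n -> S w && adj v w -> w = u.

Definition edgeless (S : pred nat) : Prop :=
  forall u v, u < n -> v < n -> S u -> S v -> ~~ adj u v.

Lemma edgeless_leaf s :
  (forall v u, v < n -> alive s v -> ~ unique_nbr s v u) -> edgeless (alive s).
Proof.
move=> noleaf u v un vn au av; apply/negP => Euv.
have [|x [y [[xn yn ax nxy] uniq]]] := has_leaf (S := alive s); first by exists u, v.
by case: (noleaf x y xn ax).
Qed.

(** A round removes a vertex unless there is no leaf, and by [has_leaf] a leaf is missing only when
    no edge survives. After [n] rounds either this has happened or no vertex is left. *)
Lemma roundsP s0 : var s0 vInf = inf -> arr s0 aBun = bun ->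
  let s := exec (For vR eliminate) s0 in
  (forall m, m < inf -> feasible n adj bun (alive s) (costs s) m <->
                        feasible n adj bun (alive s0) (costs s0) m) /\
  edgeless (alive s).
Proof.
move=> Ei Eb.
pose P i s := (forall m, m < inf -> feasible n adj bun (alive s) (costs s) m <->
                        feasible n adj bun (alive s0) (costs s0) m) /\
  (edgeless (alive s) \/ count (alive s) (iota 0 n) + i <= n).
have : P n (exec (For vR eliminate) s0).
  apply: exec_for_frame => [|i s ltin Fv Fa [Hf Hc]].
    by split=> //; right; rewrite addn0 -[leqRHS](size_iota 0) count_size.
  have Ei1 : var (set_var s vR i) vInf = inf by rewrite -Ei -Fv.
  have Eb1 : arr (set_var s vR i) aBun = bun by rewrite -Eb -Fa.
  have [H1 H2] := eliminateP Ei1 Eb1; split.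
    by move=> m ltm; apply: iff_trans (H1 m ltm) (Hf m ltm).
  case: H2 => [[noleaf ->]|[[v [u [vn av [un /andP[au Evu] _]]]] lt]].
    by left; apply: edgeless_leaf.
  case: Hc => [noE|le]; first by have := noE v u vn un av au; rewrite Evu.
  by right; move: lt; rewrite -[alive (set_var s vR i)]/(alive s); lia.
move=> [Hf Hc]; split=> // u v un vn au av.
case: Hc => [/(_ u v un vn au av) //|le].
have /eqP : count (alive (exec (For vR eliminate) s0)) (iota 0 n) = 0 by lia.
rewrite -leqn0 leqNgt -has_count => /hasP[]; exists u => //.
by rewrite mem_iota add0n.
Qed.

(** The survivors are added in increasing order, each as an isolated vertex over those already
    summed. *)
Lemma add_upP s0 m : var s0 vInf = inf -> var s0 vAns = 0 -> edgeless (alive s0) ->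
  m < inf ->
  var (exec add_up s0) vAns <= m <-> feasible n adj bun (alive s0) (costs s0) m.
Proof.
move=> Ei Ea noE ltm.
pose S i v := alive s0 v && (v < i).
pose P i s := forall m, m < inf ->
  var s vAns <= m <-> feasible n adj bun (S i) (costs s0) m.
suff H : P n (exec add_up s0).
  apply: iff_trans (H m ltm) _.
  by split; apply: feasible_eq => // v vn; rewrite /S vn andbT.
apply: exec_for_frame => [m' _|i s ltin Fv Fa Pi].
  rewrite Ea; split=> // _; exists (fun=> 0), (fun=> 0); split=> [v vn|u v _ _|].
  - by split; lia.
  - by rewrite /S andbF.
  - by rewrite big_pred0 // => v; rewrite /S andbF.
have Eal : alive s = alive s0 by apply: alive_frame; rewrite Fa.
rewrite exec_if [eval _ _]/= [eval _ _]/= [upd _ _ _ _]/= -/(alive s i) Eal.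
case: ifP => ai; last first.
  move=> m' ltm' /=; apply: iff_trans (Pi m' ltm') _.
  by split; apply: feasible_eq => // v vn; rewrite /S ltnS [v <= i]leq_eqVlt;
    case: eqP => // ->; rewrite ai.
have Ei1 : eval (set_var s vV i) (EVar vInf) = inf by rewrite /= /upd /= Fv.
rewrite !exec_seq (exec_assign vBest) Ei1.
set s1 := set_var _ vBest _.
have costs1 : costs s1 = costs s0 by rewrite /costs /= Fa.
set s2 := exec (min_costs vV (ECst 1)) s1.
have Fv2 y : y \notin [:: vD; vQ; vBest] -> var s2 y = var s1 y.
  by move=> yn; apply: exec_var.
have bP m' : m' < inf -> var s2 vBest <= m' <->
    exists d q, [/\ d < n, q < n & costs s0 i d q <= m'].
  move=> ltm'; have [H1 H2] := @min_costsP vV (ECst 1) (fun _ _ => true) s1 i m' isT erefl (fun _ _ _ => erefl).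
  split.
    by case/H1 => [|[d [q [dn qn _ le]]]]; [rewrite /= /upd /=; lia|exists d, q; rewrite -costs1].
  by move=> [d [q [dn qn le]]]; apply: H2; right; exists d, q; rewrite costs1.
have A1 : var s2 vInf = inf by rewrite Fv2 //= /upd /= Fv.
have A2 : var s2 vAns = var s vAns by rewrite Fv2.
move=> m' ltm'; rewrite exec_assign /= {1}/upd /= A1 A2 -minnE.
have := @feasible_isolated n inf adj bun (S i) (costs s0) (var s vAns) (var s2 vBest) i m' ltin.
case=> //.
- by rewrite /S ltnn andbF.
- by move=> x y xn yn Hx Hy; apply: noE => //;
    [case/orP: Hx => [/andP[]|/eqP ->]|case/orP: Hy => [/andP[]|/eqP ->]].
move=> H1 H2; split.
  move=> /H1; apply: feasible_eq => // v vn.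
  by rewrite /S ltnS [v <= i]leq_eqVlt; case: eqP => [->|]; rewrite ?ai ?orbT ?orbF.
move=> H; apply: H2; apply: feasible_eq H => // v vn.
by rewrite /S ltnS [v <= i]leq_eqVlt; case: eqP => [->|]; rewrite ?ai ?orbT ?orbF.
Qed.

End Elimination.

Lemma init_costsP s0 : let s := exec init_costs s0 in
  forall v c t, v < n -> c < n -> t < n ->
  costs s v c t = unary_cost (var s0 vInf) (arr s0 aCharge) v c t.
Proof.
pose P i s := forall v c t, v < i -> c < n -> t < n ->
  costs s v c t = unary_cost (var s0 vInf) (arr s0 aCharge) v c t.
suff H : P n (exec init_costs s0) by [].
apply: exec_for_frame => [//|i s ltin Fv Fa Pi] v c t vi cn tn.
rewrite (@fill_plane i init_cell
  (fun c t _ => unary_cost (var s0 vInf) (arr s0 aCharge) i c t)) //.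
  case: eqP => [->//|ne]; rewrite costs_set_var Pi //; lia.
move=> s' c' t' c'n t'n Hc Ht Hv Ha Hcost v1 c1 t1 c1n t1n.
rewrite /init_cell exec_if !exec_store /= Hc Ht (Hv vV) // (Hv vInf) // (Ha aCharge) //.
rewrite /set_var /= (Fa aCharge) // /upd /= (Fv vInf) //.
rewrite -/(cell i c' t') -minnE /unary_cost addn1.
by case: ifP => _; rewrite costs_set_arr.
Qed.

(** * Bundles and charges read from the input *)

Section ReadBundles.
Variables (l : nat) (rep : nat -> nat).
Definition member j v : bool := 0 < nth 0 inp (3 + n * n + j * n + v).
Definition bundle_weight j := nth 0 inp (3 + n * n + l * n + j).
Hypothesis nth_l : nth 0 inp 1 = l.
Hypothesis member_inj : forall j j' v, j < l -> j' < l -> v < n ->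
  member j v -> member j' v -> j = j'.
Hypothesis repP : forall j, j < l ->
  [/\ rep j < n, member j (rep j) & forall v, v < n -> member j v -> v <= rep j].

Lemma scan_bundleP s0 j : var s0 vJ = j -> j < l ->
  let s := exec scan_bundle s0 in
  var s vLast = rep j /\
  forall v, v < n -> arr s aBun v = if member j v then j else arr s0 aBun v.
Proof.
move=> Ej jl; have [repn memrep maxrep] := repP jl.
(* The scan is increasing, so [vLast] settles when it passes the largest member [rep j]. *)
pose P i s := (rep j < i -> var s vLast = rep j) /\
  forall v, v < n -> arr s aBun v = if (v < i) && member j v then j else arr s0 aBun v.
suff [H1 H2] : P n (exec scan_bundle s0).
  by split=> [|v vn]; [apply: H1|rewrite H2 // vn].
apply: exec_for_frame => [//|i s ltin Fv Fa [H1 H2]].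
rewrite exec_if [eval _ _]/= [eval _ _]/= /set_var /= /upd /= Fv // Ej -/(member j i).
case: ifP => mi; split.
- by rewrite !execE /= /upd /=; have := maxrep i ltin mi; lia.
- move=> v vn; rewrite !execE /= /upd /= Fv // Ej ltnS leq_eqVlt.
  by case: eqP => [->|_] /=; [rewrite mi|rewrite H2].
- move=> lt; apply: H1; move: lt; rewrite ltnS leq_eqVlt => /orP[/eqP E|//].
  by rewrite -E memrep in mi.
- move=> v vn; rewrite exec_skip /= H2 // ltnS [v <= i]leq_eqVlt.
  by case: eqP => [->|_] //=; rewrite mi andbF.
Qed.

Lemma read_bundlesP s0 : l <= n -> (forall v, arr s0 aCharge v = 0) ->
  let s := exec read_bundles s0 in
  [/\ forall j v, j < l -> v < n -> member j v -> arr s aBun v = j,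
      forall j, j < l -> arr s aCharge (rep j) = bundle_weight j,
      forall v, (forall j, j < l -> rep j != v) -> arr s aCharge v = 0 &
      forall j, j < l -> bundle_weight j <= var s vW].
Proof.
move=> ln charge0.
pose P i s :=
  [/\ forall j v, j < l -> j < i -> v < n -> member j v -> arr s aBun v = j,
      forall j, j < l -> j < i -> arr s aCharge (rep j) = bundle_weight j,
      forall v, (forall j, j < l -> rep j != v) -> arr s aCharge v = 0 &
      forall j, j < l -> j < i -> bundle_weight j <= var s vW].
suff [H1 H2 H3 H4] : P n (exec read_bundles s0).
  split=> //.
  - by move=> j v jl; apply: H1 => //; lia.
  - by move=> j jl; apply: H2 => //; lia.
  - by move=> j jl; apply: H4 => //; lia.
apply: exec_for_frame => [|i s ltin _ _ [H1 H2 H3 H4]]; first by split.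
rewrite exec_if [eval _ _]/= [eval _ _]/= -[upd _ _ _ _]/i nth_l.
case: ltnP => il; last first.
  rewrite exec_skip; split=> //=.
  - by move=> j v jl _; apply: H1 => //; lia.
  - by move=> j jl _; apply: H2 => //; lia.
  - by move=> j jl _; rewrite /upd /=; apply: H4 => //; lia.
set s1 := set_var s vJ i.
have [Elast Hbun] := @scan_bundleP s1 i erefl il.
set s2 := exec scan_bundle s1 in Elast Hbun.
have Fv y : y \notin [:: vV; vLast] -> var s2 y = var s1 y.
  by move=> yn; apply: exec_var.
have Fa : arr s2 aCharge = arr s1 aCharge by rewrite /s2 exec_arr.
rewrite !exec_seq -/s2 exec_store /= Elast (Fv vJ) // nth_l /= -/(bundle_weight i).
set s3 := set_arr _ _ _ _.
have [repn memrep _] := repP il.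
have wE s' : var s' vJ = i -> eval s' eweight = bundle_weight i.
  by move=> /= ->; rewrite nth_l.
have Ej : var s3 vJ = i by rewrite /s3 /= Fv.
have EW : var s3 vW = var s vW by rewrite /s3 /= Fv.
set s4 := exec _ s3.
have Fa4 : arr s4 = arr s3.
  by rewrite /s4 exec_if; case: ifP.
have W4 : var s vW <= var s4 vW /\ bundle_weight i <= var s4 vW.
  rewrite /s4 exec_if wE // [eval _ _]/= EW; case: ltnP => h.
    by rewrite exec_assign wE //= /upd /=; split=> //; exact: ltnW.
  by rewrite exec_skip EW.
have charge4 v : arr s4 aCharge v = if v == rep i then bundle_weight i else arr s aCharge v.
  by rewrite Fa4 /s3 /= /upd Fa.
split.
- move=> j v jl ji vn mj; rewrite Fa4 /s3 /= Hbun //.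
  case: ifP => mi; first exact: (member_inj il jl vn mi mj).
  move: ji; rewrite ltnS leq_eqVlt => /orP[/eqP E|ji]; last exact: H1.
  by rewrite E mi in mj.
- move=> j jl ji; rewrite charge4; case: eqP => E.
    have [_ memj _] := repP jl.
    by rewrite (@member_inj i j (rep i)) // -E.
  move: ji; rewrite ltnS leq_eqVlt => /orP[/eqP E'|ji]; last exact: H2.
  by case: E; rewrite E'.
- move=> v Hrep; rewrite charge4; case: eqP => [E|_]; last exact: H3.
  by have := Hrep i il; rewrite E eqxx.
- move=> j jl; rewrite ltnS leq_eqVlt => /orP[/eqP ->|ji]; first by case: W4.
  by apply: leq_trans W4.1; apply: H4.
Qed.

End ReadBundles.
End Correctness.

(** * The algorithm on an instance *)

Lemma nth_allpairs (S T : Type) (f : S -> T -> nat) x0 y0 s t i j :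
  i < size s -> j < size t ->
  nth 0 [seq f x y | x <- s, y <- t] (i * size t + j) = f (nth x0 s i) (nth y0 t j).
Proof.
elim: s i => [|x s IH] [|i] //= is_ jt; rewrite nth_cat size_map.
  by rewrite mul0n jt (nth_map y0).
rewrite ifF; last by rewrite mulSn; lia.
by rewrite (_ : _ - _ = i * size t + j) ?IH // mulSn; lia.
Qed.

Lemma nth_catl (s1 s2 : seq nat) i : i < size s1 -> nth 0 (s1 ++ s2) i = nth 0 s1 i.
Proof. by rewrite nth_cat => ->. Qed.

Lemma nth_catr (s1 s2 : seq nat) k i :
  size s1 = k -> nth 0 (s1 ++ s2) (k + i) = nth 0 s2 i.
Proof. by move=> <-; rewrite nth_cat ltnNge leq_addr /= addKn. Qed.

(** * Layout of the input, size of words, and optimality of the answer *)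

Section Encoding.
Variable I : instance.
Notation n := (nvertices I).
Notation l := (nbundles I).
Notation inp := (encode I).

Lemma size_encode : size inp = 3 + n * n + l * n + l.
Proof.
by rewrite /encode /= !size_cat !size_allpairs size_map !size_enum_ord; lia.
Qed.

Lemma size_adjacency :
  size [seq nat_of_bool (edge u v) | u <- enum 'I_n, v <- enum 'I_n] = n * n.
Proof. by rewrite size_allpairs size_enum_ord. Qed.

Lemma size_incidence :
  size [seq nat_of_bool (v \in bundle j) | j <- enum 'I_l, v <- enum 'I_n] = l * n.
Proof. by rewrite size_allpairs !size_enum_ord. Qed.

Lemma nth_edge (u v : 'I_n) : nth 0 inp (3 + u * n + v) = edge u v.
Proof.
have [un vn] := (ltn_ord u, ltn_ord v).
rewrite -addnA nth_catr // nth_catl; last by rewrite size_adjacency; nia.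
have /= := @nth_allpairs _ _ (fun u v => nat_of_bool (edge u v)) u v (enum 'I_n) (enum 'I_n) u v.
by rewrite size_enum_ord !nth_ord_enum; apply.
Qed.

Lemma nth_member (j : 'I_l) (v : 'I_n) :
  nth 0 inp (3 + n * n + j * n + v) = (v \in bundle j).
Proof.
have [jl vn] := (ltn_ord j, ltn_ord v).
rewrite -!addnA nth_catr // nth_catr; last exact: size_adjacency.
rewrite nth_catl; last by rewrite size_incidence; nia.
have /= := @nth_allpairs _ _ (fun j v => nat_of_bool (v \in bundle j)) j v
  (enum 'I_l) (enum 'I_n) j v.
by rewrite !size_enum_ord !nth_ord_enum; apply.
Qed.

Lemma nth_weight (j : 'I_l) : nth 0 inp (3 + n * n + l * n + j) = weight j.
Proof.
rewrite -!addnA nth_catr // nth_catr; last exact: size_adjacency.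
rewrite nth_catr; last exact: size_incidence.
by rewrite (nth_map j) ?size_enum_ord // nth_ord_enum.
Qed.

(** The base [X] of the compiler, chosen so that [X ^ k] equals [2 ^ word_length k I]. *)
Definition word_base : nat := 2 ^ (trunc_log 2 (n + l + budget I + \sum_(j < l) weight j)).+1.

Lemma word_base_gt : n + l + budget I + \sum_(j < l) weight j < word_base.
Proof. exact: trunc_log_ltn. Qed.

Lemma nth_encode_lt i : nth 0 inp i < word_base.
Proof.
have gt := word_base_gt; have b0 := budget_gt0 I.
have : all (fun x => x < word_base) inp.
  rewrite /encode !all_cat /=; apply/and4P; split; first lia.
  - apply/allP => _ /allpairsP[p [_ _ ->]]; case: (edge _ _) => /=; lia.
  - apply/allP => _ /allpairsP[p [_ _ ->]]; case: (_ \in _) => /=; lia.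
  - apply/allP => _ /mapP[j _ ->]; apply: leq_ltn_trans gt.
    by rewrite (bigD1 j) //=; lia.
case: (ltnP i (size inp)) => h; first by move/all_nthP; apply.
by move=> _; rewrite nth_default //; lia.
Qed.

(** The length is quadratic in the dimensions, hence below [4 * X ^ 2], and [X >= 2] absorbs the
    4. *)
Lemma size_encode_lt : size inp < word_base ^ 4.
Proof.
have gt := word_base_gt; have b0 := budget_gt0 I.
rewrite size_encode; set X := word_base in gt *.
have X2 : 2 <= X by lia.
have : (n + l) * n + l + 4 <= X * X * 4.
  have : (n + l) * n <= X * X by apply: leq_mul; lia.
  by nia.
have : X * X * 4 <= X ^ 4.
  rewrite (_ : X ^ 4 = X * X * (X * X)); last by rewrite !expnS expn0; lia.
  by rewrite leq_mul2l; apply/orP; right; nia.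
by lia.
Qed.

Hypothesis tree : is_tree (@edge I).
Hypothesis part : bundles_partition I.
Hypothesis conn : bundles_connected I.

Notation adj := (adj n inp).

Lemma adjE (u v : 'I_n) : adj u v = edge u v.
Proof. by rewrite /adj nth_edge lt0b. Qed.

Lemma adj_sym u v : u < n -> v < n -> adj u v = adj v u.
Proof.
move=> un vn; rewrite -[u]/(val (Ordinal un)) -[v]/(val (Ordinal vn)) !adjE.
exact: edge_sym.
Qed.

Lemma adj_irr u : u < n -> adj u u = false.
Proof. by move=> un; rewrite -[u]/(val (Ordinal un)) adjE edge_irr. Qed.

Lemma adj_leaf (S : pred nat) :
  (exists u v, [/\ u < n, v < n, S u, S v & adj u v]) ->
  exists v u, [/\ v < n, u < n, S v & S u && adj v u] /\
    forall w, w < n -> S w && adj v w -> w = u.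
Proof.
move=> [u [v [un vn Su Sv]]].
rewrite -[u]/(val (Ordinal un)) -[v]/(val (Ordinal vn)) adjE => Euv.
case: tree => _ _ acyc.
have [x [y [Sx Sy exy uniq]]] := acyclic_leaf (S := fun x : 'I_n => S x)
  (x := Ordinal un) (y := Ordinal vn) (@edge_sym I) (@edge_irr I) acyc Su Sv Euv.
exists x, y; split; first by split=> //; rewrite Sy adjE.
move=> w wn; rewrite -[w]/(val (Ordinal wn)) adjE => /andP[Sw exw].
by rewrite (uniq _ Sw exw).
Qed.

Lemma bundle_disjoint (j j' : 'I_l) (v : 'I_n) :
  v \in bundle j -> v \in bundle j' -> j = j'.
Proof.
move=> vj vj'; apply: (@bundle_inj I); apply/eqP; apply: contraT => ne.
case/and3P: part => _ /trivIsetP tI _.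
have := tI _ _ (imset_f _ (erefl : j \in predT)) (imset_f _ (erefl : j' \in predT)) ne.
by move/pred0P/(_ v); rewrite /= vj vj'.
Qed.

(** The largest vertex is chosen to agree with the one that the scan of the bundle leaves in
    [vLast]. *)
Lemma representatives : exists rep : 'I_l -> 'I_n,
  forall j, rep j \in bundle j /\ forall v, v \in bundle j -> v <= rep j.
Proof.
apply: (@fin_all_exists _ (fun=> 'I_n)
  (fun j r => r \in bundle j /\ forall v, v \in bundle j -> v <= r)) => j.
have /set0Pn[v0 v0j] := bundle_neq0 j.
exists [arg max_(v > v0 in bundle j) val v].
by case: arg_maxnP => // v vj vmax; split.
Qed.

Definition start : state := State (fun=> 0) (fun _ _ => 0).

Lemma algorithm_correct :
  let s := exec n inp algorithm start in
  minimum_cost I (var s vAns) /\ var s vYes = (var s vAns <= budget I).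
Proof.
have [rep repP] := representatives.
have rep_inj : injective rep.
  move=> j j' E; apply: (@bundle_disjoint _ _ (rep j)); first by case: (repP j).
  by rewrite E; case: (repP j').
have ln : l <= n by have := leq_card rep rep_inj; rewrite !card_ord.
pose repn j := if insub j is Some j' then val (rep j') else 0.
have repnE (j : 'I_l) : repn j = rep j by rewrite /repn valK.
have memberE (j : 'I_l) (v : 'I_n) : member n inp j v = (v \in bundle j).
  by rewrite /member nth_member lt0b.
have weightE (j : 'I_l) : bundle_weight n inp l j = weight j by exact: nth_weight.
rewrite /algorithm 5!exec_seq.
set s1 := exec _ _ read_bundles _; set s2 := exec _ _ set_inf _.
set s3 := exec _ _ init_costs _; set s4 := exec _ _ (For vR _) _.
set s5 := exec _ _ add_up _; set s6 := exec _ _ decide _.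
have [| |//|//|Hbun Hcharge Hcharge0 HW] := @read_bundlesP n inp l repn erefl _ _ start.
- move=> j j' v jl j'l vn.
  rewrite -[j]/(val (Ordinal jl)) -[j']/(val (Ordinal j'l)) -[v]/(val (Ordinal vn)) !memberE.
  by move=> h h'; rewrite (bundle_disjoint h h').
- move=> j jl; rewrite -[j]/(val (Ordinal jl)) repnE memberE; have [h1 h2] := repP (Ordinal jl).
  split=> // v vn; rewrite -[v]/(val (Ordinal vn)) memberE; exact: h2.
rewrite -/s1 in Hbun Hcharge Hcharge0 HW.
set W := var s1 vW in HW.
pose inf := n * l * W + 1.
have inf2 : var s2 vInf = inf by [].
have arr2 : arr s2 = arr s1 by [].
have inf3 : var s3 vInf = inf by rewrite /s3 exec_var.
have arr3 a : a != aCost -> arr s3 a = arr s1 a.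
  by move=> ne; rewrite /s3 exec_arr ?arr2 //= !inE (negbTE ne).
have inf4 : var s4 vInf = inf by rewrite /s4 exec_var.
have ans4 : var s4 vAns = 0.
  by rewrite /s4 exec_var // /s3 exec_var // /s2 exec_var // /s1 exec_var.
have [Hf noE] := roundsP adj_sym adj_irr adj_leaf inf3 (erefl (arr s3 aBun)).
rewrite -/s4 in Hf noE.
have charge_sum (v : 'I_n) : arr s1 aCharge v = \sum_(j | rep j == v) weight j.
  case: (pickP (fun j => rep j == v)) => [j /eqP jv|none].
    rewrite (big_pred1 j) -?weightE -?Hcharge ?repnE ?jv //.
    by move=> j'; rewrite -jv (inj_eq rep_inj).
  rewrite big_pred0 // Hcharge0 // => j jl; rewrite -[j]/(val (Ordinal jl)) repnE.
  by have := none (Ordinal jl); rewrite /= -val_eqE /= => ->.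
have bunE (j : 'I_l) (v : 'I_n) : v \in bundle j -> arr s3 aBun v = j.
  by move=> vj; rewrite arr3 //; apply: Hbun; rewrite ?memberE.
have repb j : rep j \in bundle j by case: (repP j).
(* Going back from the answer, the final sum, the elimination rounds and the translation of states
   into colorings each preserve the thresholds below [inf]. *)
have Hans m : m < inf -> var s5 vAns <= m <-> exists c, proper_coloring I c /\ cost I c <= m.
  move=> ltm; apply: iff_trans (add_upP (arr s3 aBun) inf4 ans4 noE ltm) _.
  apply: iff_trans (Hf m ltm) _.
  apply: iff_trans (feasible_coloring adjE bunE repb charge_sum conn ltm).
  have E v c t : v < n -> c < n -> t < n ->
      costs n s3 v c t = unary_cost inf (arr s1 aCharge) v c t.
    by move=> vn cn tn; rewrite /s3 init_costsP // inf2 arr2.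
  have al v : alive s3 v = true by rewrite /alive arr3 // /s1 exec_arr.
  by split; apply: feasible_eq => // v c t vn cn tn _; rewrite E.
have trivial_coloring : exists c, proper_coloring I c /\ cost I c < inf.
  exists (fun v => v.+1); split; first split=> // u v.
    by apply: contraTneq => -[/val_inj ->]; rewrite edge_irr.
  rewrite /inf addn1 ltnS; apply: (@leq_trans (\sum_(j < l) W * n)); last first.
    by rewrite sum_nat_const card_ord [W * n]mulnC mulnA [l * n]mulnC.
  apply: leq_sum => j _; apply: leq_mul; first by rewrite -weightE HW.
  by apply/bigmax_leqP.
have [c0 [c0p c0lt]] := trivial_coloring.
(* With this, [Hans] applies at the answer itself and yields an optimal coloring. *)
have ans_lt : var s5 vAns < inf.
  by apply: (leq_ltn_trans _ c0lt); apply/(Hans _ c0lt); exists c0.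
have ans_min c : proper_coloring I c -> var s5 vAns <= cost I c.
  move=> cp; case: (ltnP (cost I c) inf) => h; last by lia.
  by apply/(Hans _ h); exists c.
have ans6 : var s6 vAns = var s5 vAns by rewrite /s6 exec_var.
rewrite ans6; split.
  split=> //; have [c [cp cle]] := (Hans _ ans_lt).1 (leqnn _).
  by exists c; split=> //; apply/eqP; rewrite eqn_leq cle ans_min.
by rewrite /s6 exec_seq exec_if exec_assign /= ltnNge; case: (_ <= _).
Qed.

End Encoding.

(** * The complete machine program and its running time *)

Definition prologue : program :=
  [:: Const 0 0; Read rnum 0; Const 0 1; Read 1 0; Arith Mul rlen rnum rnum;
      Arith Mul 0 1 rnum; Arith Add rlen rlen 0; Arith Add rlen rlen 1;
      Const 0 3; Arith Add rlen rlen 0].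

Definition epilogue : program :=
  [:: Const 0 0; Arith Add 0 0 (rvar vYes); Const 1 0; Arith Add 1 1 (rvar vAns)].

Definition machine : program :=
  prologue ++ compile algorithm (size prologue) 0 ++ epilogue.

Lemma run_machine (I : instance) : 0 < nvertices I ->
  let n := nvertices I in
  let s := exec n (encode I) algorithm start in
  exists m : config,
    run (word_length 20 I) machine ((cmd_cost algorithm + 14) * n ^ 6) (initial I) = Some m /\
    reg m 0 = var s vYes /\ reg m 1 = var s vAns.
Proof.
move=> n_gt0 n s; set b := word_length 20 I; set X := word_base I.
have Xb : X ^ 20 = 2 ^ b by rewrite /X /word_base -expnM mulnC.
have gt := word_base_gt I; rewrite -/X -/n in gt.
have X_gt1 : 1 < X by have := budget_gt0 I; lia.
have fitsX x i : x < X ^ i -> i <= 20 -> x < 2 ^ b.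
  by move=> xi i20; rewrite -Xb; apply: leq_trans xi _; rewrite leq_exp2l.
have size_lt : size (encode I) < X ^ 4 := size_encode_lt I.
have fits4 x : x <= size (encode I) -> x < 2 ^ b.
  by move=> le; apply: (@fitsX _ 4) => //; exact: leq_ltn_trans le size_lt.
have [C1 C2] : code_at machine 0 prologue /\
    code_at machine (size prologue) (compile algorithm (size prologue) 0 ++ epilogue).
  by apply: code_at_cat; exists [::] => //; exists [::]; rewrite cats0.
have [{}C2 C3] := code_at_cat C2.
rewrite size_compile in C3.
set l := nbundles I in gt.
have sizeE : size (encode I) = 3 + n * n + l * n + l := size_encode I.
pose st k r := Config k r (nth 0 (encode I)).
pose f1 := upd (fun=> 0) 0 0.
pose f2 := upd f1 rnum n.
pose f3 := upd f2 0 1.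
pose f4 := upd f3 1 l.
pose f5 := upd f4 rlen (n * n).
pose f6 := upd f5 0 (l * n).
pose f7 := upd f6 rlen (n * n + l * n).
pose f8 := upd f7 rlen (n * n + l * n + l).
pose f9 := upd f8 0 3.
pose f10 := upd f9 rlen (n * n + l * n + l + 3).
move: C1 => /code_at_cons[P0] /code_at_cons[P1] /code_at_cons[P2] /code_at_cons[P3]
  /code_at_cons[P4] /code_at_cons[P5] /code_at_cons[P6] /code_at_cons[P7] /code_at_cons[P8]
  /code_at_cons[P9 _].
have R0 : reach b machine 1 (initial I) (st 1 f1) by apply: (@reach_const b machine _ _ (initial I) P0); apply: fits4.
have R1 : reach b machine 1 (st 1 f1) (st 2 f2).
  by apply: (@reach_read b machine _ _ (st 1 f1) P1); apply: fits4; rewrite sizeE /=; nia.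
have R2 : reach b machine 1 (st 2 f2) (st 3 f3).
  by apply: (@reach_const b machine _ _ (st 2 f2) P2); apply: fits4; rewrite sizeE.
have R3 : reach b machine 1 (st 3 f3) (st 4 f4).
  by apply: (@reach_read b machine _ _ (st 3 f3) P3); apply: fits4; rewrite sizeE /= -/l; lia.
have R4 : reach b machine 1 (st 4 f4) (st 5 f5).
  by apply: (@reach_arith b machine _ _ _ _ (st 4 f4) P4); apply: fits4;
    rewrite -[eval_arith _ _ _]/(n * n) sizeE; lia.
have R5 : reach b machine 1 (st 5 f5) (st 6 f6).
  by apply: (@reach_arith b machine _ _ _ _ (st 5 f5) P5); apply: fits4;
    rewrite -[eval_arith _ _ _]/(l * n) sizeE; lia.
have R6 : reach b machine 1 (st 6 f6) (st 7 f7).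
  by apply: (@reach_arith b machine _ _ _ _ (st 6 f6) P6); apply: fits4;
    rewrite -[eval_arith _ _ _]/(n * n + l * n) sizeE; lia.
have R7 : reach b machine 1 (st 7 f7) (st 8 f8).
  by apply: (@reach_arith b machine _ _ _ _ (st 7 f7) P7); apply: fits4;
    rewrite -[eval_arith _ _ _]/(n * n + l * n + l) sizeE; lia.
have R8 : reach b machine 1 (st 8 f8) (st 9 f9).
  by apply: (@reach_const b machine _ _ (st 8 f8) P8); apply: fits4; rewrite sizeE; lia.
have R9 : reach b machine 1 (st 9 f9) (st 10 f10).
  by apply: (@reach_arith b machine _ _ _ _ (st 9 f9) P9); apply: fits4;
    rewrite -[eval_arith _ _ _]/(n * n + l * n + l + 3) sizeE; lia.
have Rpro : reach b machine 10 (initial I) (st 10 f10).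
  exact: reach_trans R0 (reach_trans R1 (reach_trans R2 (reach_trans R3 (reach_trans R4
    (reach_trans R5 (reach_trans R6 (reach_trans R7 (reach_trans R8 R9)))))))).
(* Memory behind the input reads as the default 0 of [nth], and the prologue writes only registers
   below 4, so all arrays and variables start at 0. *)
have Rep : represents n (encode I) start (st 10 f10).
  split.
  - by [].
  - by rewrite -[reg _ _]/(n * n + l * n + l + 3) sizeE; lia.
  - by move=> x; rewrite /f10 /f9 /f8 /f7 /f6 /f5 /f4 /f3 /f2 /f1 /= /upd /rvar /rlen /rnum !addnS.
  - by [].
  - by move=> a i _; rewrite [mem _ _]/= nth_default //; lia.
have bstart : bounded X 5 dv start.
  by split=> [x|a i]; rewrite expn_gt0 ltnW.
have n_ltX : n < X by lia.
have [bs [m [Rm pcm Repm _]]] := @reach_cmd n (encode I) X 20 b 5 dv machine X_gt1 n_gt0 n_ltX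
  isT (@nth_encode_lt I) size_lt (eq_leq Xb) algorithm 0 start (st 10 f10)
  bstart Rep algorithm_fits C2.
rewrite -/s in bs Repm; rewrite -[_ + csize _]/(pc (st 10 f10) + csize algorithm) -pcm in C3.
move: C3 => /code_at_cons[Q0] /code_at_cons[Q1] /code_at_cons[Q2] /code_at_cons[Q3 _].
have zero : 0 < 2 ^ b by rewrite expn_gt0.
pose g1 := upd (reg m) 0 0.
pose g2 := upd g1 0 (var s vYes).
pose g3 := upd g2 1 0.
pose g4 := upd g3 1 (var s vAns).
pose mt k r := Config k r (mem m).
have S0 : reach b machine 1 m (mt (pc m).+1 g1) by apply: (@reach_const b machine _ _ m Q0).
have S1 : reach b machine 1 (mt (pc m).+1 g1) (mt (pc m).+2 g2).
  have := @reach_arith b machine _ _ _ _ (mt (pc m).+1 g1) Q1.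
  by rewrite /= /g1 /upd /= (rep_var Repm vYes) add0n; apply; apply: (@fitsX _ 5 (bs.1 vYes)).
have S2 : reach b machine 1 (mt (pc m).+2 g2) (mt (pc m).+3 g3).
  exact: (@reach_const b machine _ _ (mt (pc m).+2 g2) Q2).
have S3 : reach b machine 1 (mt (pc m).+3 g3) (mt (pc m).+4 g4).
  have := @reach_arith b machine _ _ _ _ (mt (pc m).+3 g3) Q3.
  by rewrite /= /g3 /g2 /g1 /upd /= (rep_var Repm vAns) add0n; apply; apply: (@fitsX _ 5 (bs.1 vAns)).
exists (mt (pc m).+4 g4); split=> //.
apply: run_reach; last first.
  apply: onth_default; rewrite /machine size_cat [size (_ ++ epilogue)]size_cat size_compile.
  by rewrite [pc (mt _ _)]/= pcm [size epilogue]/= [size prologue]/= [pc (st _ _)]/=; lia.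
apply: reach_leq (reach_trans Rpro (reach_trans Rm (reach_trans S0
  (reach_trans S1 (reach_trans S2 S3))))).
(* Five nested loops give [n ^ 5], within the claimed [n ^ 6]; the 14 counts the ten instructions of
   the prologue and the four of the epilogue. *)
rewrite depth_algorithm expnS.
have : 0 < n ^ 5 by rewrite expn_gt0 n_gt0.
by move: (cmd_cost _) (n ^ 5) => a y; nia.
Qed.

Theorem theorem8 :
  exists p : program,
    solves_in_time
      (fun I : instance =>
         [/\ is_tree (@edge I), bundles_partition I & bundles_connected I])
      (fun n => n ^ 6) p.
Proof.
exists machine, 20, (cmd_cost algorithm + 14) => I [tree part conn].
have n_gt0 : 0 < nvertices I by case: tree.
have [m [run_m [yes ans]]] := run_machine n_gt0.
have [opt yesE] := algorithm_correct tree part conn.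
exists m; split=> //; split; last by rewrite ans.
exists (var (exec (nvertices I) (encode I) algorithm start) vAns <= budget I).
split; first by rewrite yes yesE.
case: opt => [[c [cp cost_c]] opt]; split.
  by move=> le; exists c; rewrite cost_c.
by move=> [c' [c'p le]]; apply: leq_trans (opt c' c'p) le.
Qed.
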